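(* Suppose that $k\ge1$ is a fixed integer. Then for all integers $n$ with $1\le k\le n/2$ and prime powers $q$ with $|SL(n,q)|$ sufficiently large, the proportion of elements in any coset $gSL(n,q)$ of $SL(n,q)$ in $GL(n,q)$ which are regular semisimple and derangements on $k$-spaces is at least $1/16$.
   Context: An element of $GL(n,q)$ is regular semisimple if its characteristic polynomial is squarefree; it is a derangement on $k$-spaces if it leaves invariant no $k$-dimensional subspace of $\mathbb{F}_q^n$. ''Sufficiently large'' may depend on $k$. *)

(* Defs.v *)
From mathcomp Require Import all_boot all_order all_algebra all_fingroup.
From mathcomp Require Import boolp.

Set Implicit Arguments.
Unset Strict Implicit.
Unset Printing Implicit Defensive.

Import GRing.Theory.

Local Open Scope ring_scope.

(* {'GL_n[F]} consists of matrices of size n.-1.+1, so everything below has *)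
(* its intended meaning only for n > 0.                                     *)

Section SpecialLinear.

Variables (n : nat) (F : finFieldType).

Definition SL : {set {'GL_n[F]}} := [set g | \det (GLval g) == 1].

Lemma SL_group_set : group_set SL.
Proof.
apply/group_setP; split; first by rewrite inE GL_1E det1.
by move=> x y; rewrite !inE GL_ME det_mulmx => /eqP-> /eqP->; rewrite mulr1.
Qed.

Canonical SL_group := Group SL_group_set.

End SpecialLinear.

Definition squarefree_poly (F : fieldType) (p : {poly F}) : Prop :=
  forall u : {poly F}, size u != 1%N -> ~~ (u ^+ 2 %| p).

Definition regular_semisimple (n : nat) (F : finFieldType) (g : {'GL_n[F]}) :
  Prop := squarefree_poly (char_poly (GLval g)).

(* The natural module is the space of row vectors, acted on from the right; *)
(* its k-dimensional subspaces are the row spaces of the rank k matrices U. *)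
Definition derangement_on_spaces (k n : nat) (F : finFieldType)
    (g : {'GL_n[F]}) : Prop :=
  ~ exists U : 'M[F]_n.-1.+1, \rank U = k /\ stablemx U (GLval g).

Definition proportion (T : finType) (A : {set T}) (P : T -> Prop) : rat :=
  #|[set x in A | `[< P x >]]|%:R / #|A|%:R.

(* Main.v *)
(** A squarefree monic polynomial f of degree n with f(0) <> 0 is the
characteristic polynomial of at least |GL(n,q)| / q^n elements, since a matrix
commuting with a companion matrix is determined by its first row.  An invariant
k-space forces a factor of degree k.  So it suffices to find
q^n / (16 (q - 1)) squarefree monic polynomials of degree n with a prescribed
nonzero constant term and no factor of degree k.

Take products h r where h is squarefree of degree j < k with h(0) <> 0, and r
is squarefree with all irreducible factors of degree > k.  There are at least
q^j / 4 choices of h (one if j = 0).  Let T_m(c) be the number of such r of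
degree m with r(0) = c.  Counting pairs (phi, r) with phi an irreducible factor
of r gives, up to a correction for repeated factors,
  m T_m(c) >= sum_i i sum_phi T_{m-i}(c / phi(0)),
phi of degree i.  As the number of phi of degree i with prescribed constant
term is close to q^i / (i (q - 1)) (elements of given norm in the extension of
degree i), with errors whose sum is bounded, induction yields
T_m(c) >= q^m / (4 (k + 3) (q - 1)) for all m > k, just as the proportion of
permutations of m points without cycles of length <= k is >= 1 / (2k + 1).
Summing over j < k gives (1 + (k - 1) / 4) / (4 (k + 3)) = 1 / 16. *)

Require Import Defs.
From mathcomp Require Import all_boot all_order all_algebra all_fingroup.
From mathcomp Require Import all_solvable all_field boolp zify ring lra.
Set Implicit Arguments.
Unset Strict Implicit.
Unset Printing Implicit Defensive.
Import Order.TTheory GRing.Theory Num.Theory.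
Local Open Scope ring_scope.

(** * Lists of monic polynomials of given degree *)

(** [{poly F}] is not a finite type, so all counting runs over duplicate-free lists. *)
Fixpoint monics (F : finFieldType) (m : nat) : seq {poly F} :=
  if m is m'.+1 then [seq g * 'X + c%:P | c <- enum F, g <- monics F m']
  else [:: 1].

Section Monics.

Variable F : finFieldType.
Local Notation q := #|F|.

Lemma MXaddC_inj (g h : {poly F}) (c d : F) :
  g * 'X + c%:P = h * 'X + d%:P -> g = h /\ c = d.
Proof.
move=> e; have ecd : c = d.
  by have := congr1 (fun p : {poly F} => p`_0) e; rewrite !coefD !coefMX !coefC !add0r.
split=> //; apply/polyP=> i; have := congr1 (fun p : {poly F} => p`_i.+1) e.
by rewrite !coefD !coefMX !coefC /= !addr0.
Qed.

Lemma mem_monics m (f : {poly F}) :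
  (f \in monics F m) = (f \is monic) && (size f == m.+1).
Proof.
elim: m f => [|m IHm] f /=.
  rewrite inE; apply/eqP/andP=> [->|[fm /size_poly1P[c c0 def_f]]].
    by rewrite monic1 size_poly1.
  by move: fm; rewrite def_f monicE lead_coefC => /eqP->.
apply/allpairsP/andP=> [[[c g] /= [_]]|[fm /eqP sf]].
  rewrite IHm => /andP[gm /eqP sg] ->.
  have sgX : size (g * 'X) = m.+2 by rewrite size_mulX ?sg // -size_poly_eq0 sg.
  have sc : (size c%:P < size (g * 'X)%R)%N.
    by rewrite sgX size_polyC ltnS; case: (c != 0).
  by rewrite monicE lead_coefDl // lead_coefMX -monicE gm size_polyDl // sgX.
move: fm sf; elim/poly_ind: f => [|g c _]; first by rewrite size_poly0.
move=> fm sf; exists (c, g); split=> //=; first by rewrite mem_enum.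
have g0 : g != 0.
  apply: contra_eqN sf => /eqP->; rewrite mul0r add0r size_polyC.
  by case: (c != 0).
have sg : size g = m.+1.
  by move: sf; rewrite size_MXaddC (negPf g0) => -[].
have sc : (size c%:P < size (g * 'X)%R)%N.
  by rewrite size_mulX // sg size_polyC ltnS; case: (c != 0).
by rewrite IHm sg eqxx andbT monicE -lead_coefMX -(lead_coefDl sc).
Qed.

Lemma monics_uniq m : uniq (monics F m).
Proof.
elim: m => // m IHm /=; apply: allpairs_uniq; rewrite ?enum_uniq //.
by move=> [c g] [d h] _ _ /= /MXaddC_inj[-> ->].
Qed.

Lemma size_monics m : size (monics F m) = (q ^ m)%N.
Proof. by elim: m => // m IHm; rewrite /= size_allpairs IHm -cardE expnS. Qed.

Lemma size_monics_coef0 m (c : F) :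
  size [seq f : {poly F} <- monics F m.+1 | f`_0 == c] = (q ^ m)%N.
Proof.
rewrite -size_monics -(size_map (fun g => g * 'X + c%:P) (monics F m)).
apply/perm_size/uniq_perm; rewrite ?filter_uniq ?monics_uniq //.
  by rewrite map_inj_uniq ?monics_uniq // => g h /MXaddC_inj[].
move=> f; rewrite mem_filter; apply/andP/mapP => [[f0 /allpairsP[[d g] /= [_ gm def_f]]]|].
  exists g => //; move: f0; rewrite def_f coefD coefMX coefC add0r.
  by move=> /eqP->.
case=> g gm ->; rewrite coefD coefMX coefC add0r eqxx; split=> //.
by apply/allpairsP; exists (c, g); rewrite mem_enum.
Qed.

Lemma size_monics_coef0_leq m (c : F) :
  (size [seq f : {poly F} <- monics F m | (f`_0 == c)%R] <= q ^ m.-1)%N.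
Proof.
(* In degree 0 the truncated predecessor leaves the bound 1, and the list has a single entry. *)
case: m => [|m]; last by rewrite size_monics_coef0.
by rewrite size_filter (leq_trans (count_size _ _)).
Qed.

Lemma size_monics_sub m (f g : {poly F}) :
  f \in monics F m -> g \in monics F m -> (size (f - g)%R <= m)%N.
Proof.
rewrite !mem_monics => /andP[/monicP lf /eqP sf] /andP[/monicP lg /eqP sg].
apply/leq_sizeP => j; rewrite leq_eqVlt coefB => /orP[/eqP<-|mj].
  by move: lf lg; rewrite /lead_coef sf sg => -> ->; rewrite subrr.
by rewrite !nth_default ?subrr // ?sf ?sg.
Qed.

End Monics.

(** * Irreducible polynomials with prescribed constant term *)

Definition irreducibles (F : finFieldType) (i : nat) (c : F) : seq {poly F} :=
  [seq f : {poly F} <- monics F i | `[< irreducible_poly f >] && (f`_0 == c)].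

Section FrobeniusOrbits.

Variables (F : finFieldType) (L : splittingFieldType F).
Local Notation q := #|F|.
Local Notation "p ^%:A" := (map_poly (in_alg L) p) (at level 2, format "p ^%:A").

(** Raising to the power q is a Galois automorphism fixing [F], so it commutes with evaluation. *)
Lemma horner_in_alg_expf_card (p : {poly F}) (x : L) (e : nat) :
  p^%:A.[x] ^+ (q ^ e) = p^%:A.[x ^+ (q ^ e)].
Proof.
have [/= alpha _ Dalpha] := finField_galois_generator (sub1v {:L}%AS).
elim: e => [|e IHe]; first by rewrite expn0 !expr1.
rewrite expnSr !exprM IHe.
have DA y : y ^+ q = alpha y by rewrite Dalpha ?memvf // dimv1 expn1.
rewrite !DA -horner_map; congr (_.[_]); rewrite -map_poly_comp.
by apply: eq_map_poly => a /=; rewrite linearZ rmorph1.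
Qed.

Lemma expf_card_adjoin_degree (x : L) : x ^+ (q ^ adjoin_degree 1 x) = x.
Proof.
have := Fermat's_little_theorem <<1; x>>%AS x.
by rewrite memv_adjoin dim_Fadjoin dimv1 muln1 => /esym/eqP.
Qed.

Lemma size_Xn_card_subX (R : comNzRingType) n : (1 < n)%N -> size ('X^n - 'X : {poly R}) = n.+1.
Proof. by move=> n1; rewrite size_polyDl size_polyXn // size_polyN size_polyX. Qed.

(** With x, all values p(x) are fixed by the power q^e. The values at the q^d monic p of degree d
    are distinct, since differences have degree below d, and they are roots of X^(q^e) - X; so q^d
    <= q^e. *)
Lemma adjoin_degree_leq (x : L) (e : nat) :
  (0 < e)%N -> x ^+ (q ^ e) = x -> (adjoin_degree 1 x <= e)%N.
Proof.
move=> e0 xe; pose d := adjoin_degree 1 x.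
have q1 : (1 < q)%N := finNzRing_gt1 F.
have qe1 : (1 < q ^ e)%N by rewrite -(expn0 q) ltn_exp2l.
pose rs := [seq (p : {poly F})^%:A.[x] | p <- monics F d].
have urs : uniq rs.
  rewrite map_inj_in_uniq ?monics_uniq // => f g.
  move=> fm gm fg; apply/eqP; rewrite -subr_eq0 -(map_poly_eq0 (in_alg L)).
  rewrite -(@root_small_adjoin_poly _ _ 1 x).
  - by rewrite rmorphB /= rootE hornerD hornerN fg subrr.
  - exact: alg_polyOver.
  - by rewrite size_map_poly size_monics_sub.
have P0 : 'X^(q ^ e) - 'X != 0 :> {poly L}.
  by rewrite -size_poly_gt0 size_Xn_card_subX.
have rP : all (root ('X^(q ^ e) - 'X)) rs.
  apply/allP=> _ /mapP[p _ ->]; rewrite rootE hornerD hornerN hornerXn hornerX.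
  by rewrite horner_in_alg_expf_card xe subrr.
have := max_poly_roots P0 rP urs.
by rewrite size_Xn_card_subX // size_map size_monics ltnS leq_exp2l.
Qed.

Lemma minPoly_prod_frobenius (x : L) (d := adjoin_degree 1 x) :
  minPoly 1 x = \prod_(j < d) ('X - (x ^+ (q ^ j))%:P).
Proof.
have d0 : (0 < d)%N by [].
pose rs := [seq x ^+ (q ^ j) | j <- iota 0 d].
have /polyOver1P[p Dp] := minPolyOver 1 x.
have urs : uniq rs.
  apply/(uniqP 0) => a b; rewrite !inE size_map size_iota => ad bd.
  wlog: a b ad bd / (a <= b)%N.
    by move=> W; case/orP: (leq_total a b) => ab e; [|symmetry]; apply: W.
  rewrite leq_eqVlt => /predU1P[//|ab].
  rewrite !(nth_map 0%N) ?size_iota // !nth_iota // !add0n => e.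
  suff: (d <= b - a)%N.
    by move=> le; have := leq_ltn_trans (leq_trans le (leq_subr a b)) bd; rewrite ltnn.
  apply: adjoin_degree_leq; first by rewrite subn_gt0.
  have xd := expf_card_adjoin_degree x; rewrite -/d in xd.
  (* Going once round the cycle: x^(q^(b-a)) = x^(q^(b+d-a)), where x^(q^b) may be replaced by
     x^(q^a), which leaves x^(q^d) = x. *)
  have dE : (d + (b - a) = b + (d - a))%N by lia.
  by rewrite -[X in X ^+ _]xd -exprM -expnD dE expnD exprM -e -exprM -expnD subnKC // ltnW.
have rP : all (root (minPoly 1 x)) rs.
  apply/allP => _ /mapP[j _ ->].
  rewrite rootE Dp -horner_in_alg_expf_card -Dp minPolyxx expr0n expn_eq0.
  by rewrite -leqn0 leqNgt (ltnW (finNzRing_gt1 F)).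
rewrite (all_roots_prod_XsubC _ rP) ?uniq_rootsE //; last first.
  by rewrite size_map size_iota size_minPoly.
by rewrite (monicP (monic_minPoly 1 x)) scale1r big_map -[d]subn0 -/(index_iota 0 d) big_mkord.
Qed.

End FrobeniusOrbits.

Lemma count_leq_sum (S T : eqType) (I : seq S) (r : seq T) (P : pred T) (Q : S -> pred T) :
    {in r, forall x, P x -> has (Q^~ x) I} ->
  (count P r <= \sum_(i <- I) count (Q i) r)%N.
Proof.
elim: r => [|x r IHr] PQ; first by rewrite big1.
rewrite /= big_split /= leq_add ?IHr //; last first.
  by move=> y ry; apply: PQ; rewrite inE ry orbT.
case Px: (P x) => //=; have /hasP[i iI Qix] := PQ x (mem_head _ _) Px.
by rewrite (big_rem i) //= Qix.
Qed.

Lemma count_root_leq (R : idomainType) (p : {poly R}) (rs : seq R) :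
  p != 0 -> uniq rs -> (count (root p) rs <= (size p).-1)%N.
Proof.
move=> p0 urs; rewrite -size_filter -ltnS prednK ?size_poly_gt0 //.
by apply: max_poly_roots; rewrite ?filter_uniq ?filter_all.
Qed.

Lemma separable_XnsubC (F : fieldType) (n : nat) (c : F) :
  n%:R != 0 :> F -> c != 0 -> separable_poly ('X^n - c%:P).
Proof.
move=> n0 c0; have n_gt0 : (0 < n)%N by case: n n0 => //; rewrite eqxx.
rewrite unlock derivB derivXn derivC subr0 -scaler_nat coprimepZr //.
apply: coprimep_expr; rewrite coprimepX rootE hornerD hornerN hornerC hornerXn.
by rewrite expr0n gtn_eqF // sub0r oppr_eq0.
Qed.

Section CountIrreducibles.

Variable F : finFieldType.
Local Notation q := #|F|.

Lemma natr_card_eq0 : q%:R = 0 :> F.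
Proof.
by rewrite -FinRing.zmodXgE -cardsT expg_cardG ?inE.
Qed.

(* [b] is the number of roots of 'X^s - (-1)^i c, with s = 1 + q + .. + q^(i-1),
   that generate a proper subfield of the extension of degree i. *)
Lemma card_irreducibles (i : nat) (c : F) : (0 < i)%N -> c != 0 ->
  exists b : nat,
  [/\ (\sum_(j < i) q ^ j <= i * size (irreducibles i c) + b)%N,
      (b <= \sum_(1 <= e < i./2.+1) (q ^ e).-1)%N & i = 2 -> (b <= 2)%N].
Proof.
move=> i0 c0; pose s := (\sum_(j < i) q ^ j)%N.
have q1 : (1 < q)%N := finNzRing_gt1 F.
(* Only the term j = 0 survives in [F], so s is 1 there and X^s - c' will be separable. *)
have s0 : s%:R != 0 :> F.
  rewrite /s -(prednK i0) big_ord_recl expn0 natrD natr_sum big1 ?addr0 ?oner_eq0 //.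
  by move=> j _; rewrite /= natrX natr_card_eq0 expr0n.
have s_gt0 : (0 < s)%N by rewrite lt0n; apply: contraNneq s0 => ->.
(* An element x of degree i has norm x^s and a minimal polynomial with constant term (-1)^i x^s, so
   norm [c'] means constant term [c]. *)
pose c' := (-1) ^+ i * c.
have c'0 : c' != 0 by rewrite mulf_neq0 // signr_eq0.
have sep := separable_XnsubC s0 c'0.
have [L [rs Drs _]] := FinSplittingFieldFor (separable_poly_neq0 sep).
have Dp : map_poly (in_alg L) ('X^s - c'%:P) = 'X^s - (c'%:A)%:P.
  by rewrite rmorphB /= map_polyXn map_polyC.
have urs : uniq rs.
  by rewrite -separable_prod_XsubC -(eqp_separable Drs) separable_map.
have szrs : size rs = s.
  apply/eqP; rewrite -eqSS -(size_prod_XsubC rs id) -(eqp_size Drs) size_map_poly.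
  by rewrite size_XnsubC.
have xs x : x \in rs -> x ^+ s = c'%:A.
  rewrite -root_prod_XsubC -(eqp_root Drs) Dp rootE hornerD hornerN hornerXn hornerC.
  by rewrite subr_eq0 => /eqP.
have c'A : c'%:A != 0 :> L by rewrite scaler_eq0 oner_eq0 orbF.
have x0 x : x \in rs -> x != 0.
  by move=> rx; apply: contra_neq c'A => x0; rewrite -(xs _ rx) x0 expr0n gtn_eqF.
have qi : (q ^ i = q.-1 * s + 1)%N by rewrite -predn_exp addn1 prednK // expn_gt0 ltnW.
(* The roots lie in the extension of degree i: x^(q^i) = x (x^s)^(q-1), and x^s is a nonzero element
   of [F]. *)
have xqi x : x \in rs -> x ^+ (q ^ i) = x.
  move=> rx; rewrite qi exprD expr1 mulnC exprM (xs _ rx).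
  suff -> : c'%:A ^+ q.-1 = 1 :> L by rewrite mul1r.
  rewrite -[c'%:A]/(in_alg L c') -rmorphXn /=; apply: (mulfI c'A); rewrite mulr1.
  by rewrite -[c'%:A]/(in_alg L c') -rmorphM /= -exprS prednK ?expf_card // ltnW.
pose bad (x : L) := adjoin_degree 1 x != i.
have good x : x \in rs -> ~~ bad x ->
    has (fun f => root (map_poly (in_alg L) f) x) (irreducibles i c).
  move=> rx /negPn/eqP di; have /polyOver1P[f Df] := minPolyOver 1 x.
  apply/hasP; exists f; last by rewrite -Df root_minPoly.
  have sf : size f = i.+1 by rewrite -(size_map_poly (in_alg L)) -Df size_minPoly di.
  rewrite mem_filter mem_monics sf eqxx andbT -(map_monic (in_alg L)) -Df monic_minPoly andbT.
  apply/andP; split.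
    apply/asboolP; split=> [|g sg gf]; first by rewrite sf.
    have := @minPoly_irr _ _ 1 x (map_poly (in_alg L) g) (alg_polyOver _ _).
    rewrite Df dvdp_map eqp_map => /(_ gf)/orP[//|].
    by rewrite -(rmorph1 (map_poly (in_alg L))) eqp_map -size_poly_eq1 (negPf sg).
  apply/eqP/(fmorph_inj (in_alg L)); rewrite -coef_map -Df -horner_coef0.
  rewrite minPoly_prod_frobenius horner_prod di.
  under eq_bigr => j _ do rewrite hornerXsubC sub0r.
  rewrite prodrN card_ord -(@big_morph _ _ (fun n => x ^+ n) _ _ _ _ (exprD x) (expr0 x)).
  rewrite -/s (xs _ rx).
  by rewrite -[c'%:A]/(in_alg L c') -(rmorph_sign (in_alg L)) -rmorphM signrMK.
(* Fixed by the powers q^i and q^d, such a root is also fixed by the power q^(i-d), so d <= i -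
   d. *)
have bad_le x : x \in rs -> bad x -> (0 < adjoin_degree 1 x <= i./2)%N.
  move=> rx bx; have := adjoin_degree_leq i0 (xqi _ rx).
  rewrite leq_eqVlt (negPf bx) => /= lt_di.
  have xd := expf_card_adjoin_degree x; set d := adjoin_degree 1 x in lt_di xd *.
  have : (d <= i - d)%N.
    apply: adjoin_degree_leq; first by rewrite subn_gt0.
    by rewrite -[X in X ^+ _]xd -exprM -expnD subnKC ?xqi // ltnW.
  by clear; lia.
have count_good : (count (predC bad) rs <= i * size (irreducibles i c))%N.
  apply: leq_trans (count_leq_sum good) _.
  rewrite -sum1_size big_distrr /= big_seq [leqRHS]big_seq.
  apply: leq_sum => f; rewrite mem_filter mem_monics => /andP[_ /andP[fm /eqP sf]].
  apply: leq_trans (count_root_leq _ urs) _; last by rewrite size_map_poly sf muln1.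
  by rewrite map_poly_eq0 monic_neq0.
exists (count bad rs); split.
- by rewrite -/s -szrs -(count_predC bad) addnC leq_add2r.
- pose Q e := root ('X^((q ^ e).-1) - 1 : {poly L}).
  apply: (@leq_trans (\sum_(1 <= e < i./2.+1) count (Q e) rs)).
    apply: count_leq_sum => x rx /bad_le-/(_ rx) dx; apply/hasP.
    exists (adjoin_degree 1 x); first by rewrite mem_index_iota.
    rewrite /Q rootE !hornerE ?hornerXn subr_eq0; apply/eqP/(mulfI (x0 x rx)).
    by rewrite -exprS prednK ?expn_gt0 ?(ltnW q1) // mulr1 expf_card_adjoin_degree.
  rewrite big_nat [leqRHS]big_nat; apply: leq_sum => e /andP[e0 _].
  have qe : (0 < (q ^ e).-1)%N by rewrite -ltnS prednK ?expn_gt0 ?(ltnW q1) // -(expn0 q) ltn_exp2l.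
  apply: leq_trans (count_root_leq _ urs) _; last by rewrite size_Xn_sub_1.
  by rewrite -size_poly_gt0 size_Xn_sub_1.
(* For i = 2 a bad root lies in [F], so its norm x^(1+q) is x^2, and at most two such x have norm
   [c']. *)
move=> i2; have xx x : x \in rs -> bad x -> root ('X^2 - (c'%:A)%:P : {poly L}) x.
  move=> rx bx; have := bad_le x rx bx; rewrite i2 => le1.
  have d1 : adjoin_degree 1 x = 1%N by apply/eqP; rewrite eqn_leq andbC.
  rewrite rootE !hornerE ?hornerXn subr_eq0 -(xs x rx) /s i2 big_ord_recl big_ord1.
  rewrite expn0 expn1 exprD expr1 expr2; apply/eqP; congr (_ * _).
  by rewrite -{1}(expf_card_adjoin_degree x) d1 expn1.
have : (count bad rs <= count (root ('X^2 - (c'%:A)%:P : {poly L})) rs)%N.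
  rewrite -!size_filter; apply: uniq_leq_size; first by rewrite filter_uniq.
  by move=> x; rewrite !mem_filter => /andP[bx rx]; rewrite rx xx.
move/leq_trans; apply; apply: leq_trans (count_root_leq _ urs) _.
  by rewrite -size_poly_gt0 size_XnsubC.
by rewrite size_XnsubC.
Qed.

End CountIrreducibles.

(** * Products with a rough factor *)

(** Equivalently, all irreducible factors have degree greater than [k]; the form with arbitrary
    divisors applies directly to gcds. *)
Definition rough_poly (F : fieldType) (k : nat) (f : {poly F}) : Prop :=
  forall d : {poly F}, d %| f -> (size d <= k.+1)%N -> (size d <= 1)%N.

Section RoughPolynomials.

Variable F : fieldType.
Implicit Types f g h r d u phi : {poly F}.

Lemma squarefree_poly_neq0 f : squarefree_poly f -> f != 0.
Proof.
by move=> sf; apply: contraNneq (sf 0 _) => [->|]; rewrite ?dvdp0 // size_poly0.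
Qed.

Lemma squarefree_poly1 : squarefree_poly (1 : {poly F}).
Proof.
by move=> u; apply: contraNN => u2; rewrite -dvdp1 (dvdp_trans _ u2) // expr2 dvdp_mulIl.
Qed.

Lemma coprimep_rough k h r :
  rough_poly k r -> h != 0 -> (size h <= k.+1)%N -> coprimep h r.
Proof.
move=> rr h0 sh; rewrite /coprimep eqn_leq size_poly_gt0 gcdp_eq0 (negPf h0) andbT.
apply: rr; first exact: dvdp_gcdr.
exact: leq_trans (dvdp_leq h0 (dvdp_gcdl _ _)) sh.
Qed.

Lemma size_neq1_gt1 f : f != 0 -> size f != 1%N -> (1 < size f)%N.
Proof. by rewrite -size_poly_gt0; case: (size f) => [|[]]. Qed.

(** Suppose u^2 divides h r. If u is coprime to r, then u^2 divides h. Otherwise gcd(u, r) is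
    nonconstant and coprime to h, so its square divides r. *)
Lemma squarefree_poly_mul_rough k h r :
    squarefree_poly h -> (size h <= k.+1)%N -> squarefree_poly r -> rough_poly k r ->
  squarefree_poly (h * r).
Proof.
move=> sh hk sr rr u su; apply/negP => uhr.
have h0 := squarefree_poly_neq0 sh; have r0 := squarefree_poly_neq0 sr.
have chr := coprimep_rough rr h0 hk.
have [cur|ncur] := boolP (coprimep u r).
  by case/negP: (sh u su); move: uhr; rewrite Gauss_dvdpl // coprimep_expl.
have /negP[] := sr _ ncur; have ceh : coprimep (gcdp u r) h.
  by rewrite coprimep_sym (coprimep_dvdl (dvdp_gcdr u r)).
rewrite -(@Gauss_dvdpr _ _ h) ?coprimep_expl //.
exact: dvdp_trans (dvdp_exp2r _ (dvdp_gcdl _ _)) uhr.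
Qed.

(** A divisor of degree [k] would be coprime to [r], hence divide [h], whose degree is smaller. *)
Lemma size_dvdp_mul_rough k h r d :
    h != 0 -> (size h <= k)%N -> rough_poly k r -> d %| h * r ->
  size d <> k.+1.
Proof.
move=> h0 hk rr dhr sd.
have d0 : d != 0 by rewrite -size_poly_eq0 sd.
have cdr : coprimep d r by apply: coprimep_rough rr d0 _; rewrite sd.
move: dhr; rewrite Gauss_dvdpl // => /(dvdp_leq h0).
by rewrite sd leqNgt ltnS hk.
Qed.

(** [h] is coprime to [r'], so it divides [h'], and conversely. *)
Lemma rough_factorization_inj k h r h' r' :
    h \is monic -> h' \is monic -> (size h <= k)%N -> (size h' <= k)%N ->
    rough_poly k r -> rough_poly k r' -> h * r = h' * r' ->
  h = h' /\ r = r'.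
Proof.
move=> hm hm' hk hk' rr rr' e; have h0 := monic_neq0 hm; have h0' := monic_neq0 hm'.
have ehh : h = h'.
  apply/eqP; rewrite -eqp_monic //; apply/andP; split.
    by rewrite -(Gauss_dvdpl _ (coprimep_rough rr' h0 (leqW hk))) -e dvdp_mulIl.
  by rewrite -(Gauss_dvdpl _ (coprimep_rough rr h0' (leqW hk'))) e dvdp_mulIl.
by split=> //; move: e; rewrite ehh => /(mulfI h0').
Qed.

Lemma irreducible_neq0 phi : irreducible_poly phi -> phi != 0.
Proof. by case=> s _; rewrite -size_poly_gt0 ltnW. Qed.

Lemma squarefree_poly_mul_irreducible phi g :
    irreducible_poly phi -> ~~ (phi %| g) -> squarefree_poly g ->
  squarefree_poly (phi * g).
Proof.
move=> ip npg sg u su; apply/negP => upg.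
have phi0 := irreducible_neq0 ip.
have [pu|npu] := boolP (phi %| u).
  case/negP: npg; rewrite -(dvdp_mul2l _ _ phi0) -expr2.
  exact: dvdp_trans (dvdp_exp2r _ pu) upg.
case/negP: (sg u su); rewrite -(@Gauss_dvdpr _ _ phi) //.
by rewrite coprimep_expl // coprimep_sym irreducible_poly_coprime.
Qed.

Lemma rough_poly_mul_irreducible k phi g :
    irreducible_poly phi -> (k.+1 < size phi)%N -> g != 0 -> rough_poly k g ->
  rough_poly k (phi * g).
Proof.
move=> ip sp g0 rg d dpg dk; apply: (rg d _ dk).
have phi0 := irreducible_neq0 ip.
have d0 : d != 0 by apply: contraTneq dpg => ->; rewrite dvd0p mulf_eq0 negb_or phi0.
rewrite -(@Gauss_dvdpr _ _ phi) // coprimep_sym irreducible_poly_coprime //.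
by apply/negP => /(dvdp_leq d0); rewrite leqNgt (leq_ltn_trans dk sp).
Qed.

(** Divide by one factor at a time: the remaining ones are coprime to it and still divide the
    quotient. *)
Lemma sum_size_irreducible_dvdp (s : seq {poly F}) f :
    f != 0 -> uniq s ->
    {in s, forall phi, [/\ phi \is monic, irreducible_poly phi & phi %| f]} ->
  (\sum_(phi <- s) (size phi).-1 <= (size f).-1)%N.
Proof.
elim: s f => [|phi s IHs] f f0; first by rewrite big_nil.
move=> /= /andP[phis us] Hs; rewrite big_cons.
have [pm ip pf] := Hs _ (mem_head _ _).
have /dvdpP[g Dg] := pf; have phi0 := irreducible_neq0 ip.
have g0 : g != 0 by apply: contraNneq f0 => g0; rewrite Dg g0 mul0r.
have := IHs g g0 us; rewrite Dg size_mul //.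
have -> : ((size g + size phi).-1.-1 = (size phi).-1 + (size g).-1)%N.
  move: (g0) (phi0); rewrite -!size_poly_gt0; case: (size g) (size phi) => [|a] [|b] //= _ _.
  by rewrite addnS addnC.
rewrite leq_add2l; apply=> psi psis.
have [|qm iq qf] := Hs psi _; first by rewrite inE psis orbT.
split=> //.
rewrite -(@Gauss_dvdpl _ g phi) -?Dg // irreducible_poly_coprime //.
apply: contra phis => qp; suff <- : psi = phi by [].
apply/eqP; rewrite -eqp_monic //; case: ip => _; apply=> //.
by case: iq => s1 _; rewrite gtn_eqF.
Qed.

End RoughPolynomials.

(** * Rough squarefree polynomials: the numbers T_m(c) *)

Definition rough_squarefree (F : finFieldType) (k m : nat) (c : F) : seq {poly F} :=
  [seq f : {poly F} <- monics F m |
    [&& `[< rough_poly k f >], `[< squarefree_poly f >] & f`_0 == c]].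

Section CountRough.

Variable F : finFieldType.
Local Notation q := #|F|.
Implicit Types (f g h r phi : {poly F}) (c : F).

Lemma rough_squarefreeP k m c f :
  reflect [/\ f \is monic, size f = m.+1, rough_poly k f, squarefree_poly f & f`_0 = c]
          (f \in rough_squarefree k m c).
Proof.
rewrite mem_filter mem_monics; apply: (iffP andP).
  by case=> /and3P[/asboolP ? /asboolP ? /eqP ?] /andP[? /eqP ?].
by case=> fm /eqP sf /asboolP rf /asboolP qf /eqP f0; rewrite rf qf f0 fm.
Qed.

Lemma rough_squarefree_uniq k m c : uniq (rough_squarefree k m c).
Proof. by rewrite filter_uniq ?monics_uniq. Qed.

Lemma flatten_monics_uniq (s : seq nat) :
  uniq s -> uniq (flatten [seq monics F i | i <- s]).
Proof.
elim: s => //= i s IHs /andP[is_ us]; rewrite cat_uniq monics_uniq IHs // andbT.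
apply/hasPn => f /flatten_mapP[j js]; rewrite !mem_monics => /andP[-> /eqP->] /=.
by rewrite eqSS; apply: contraNneq is_ => <-.
Qed.

(** Multiplication by [phi] is injective, and excluding multiples of [phi] keeps the product
    squarefree. *)
Lemma count_mul_irreducible k i m c phi :
    (k < i <= m)%N -> phi \in monics F i -> irreducible_poly phi -> phi`_0 != 0 ->
  (count (fun g => ~~ (phi %| g)%R) (rough_squarefree k (m - i) (c / phi`_0)%R)
     <= count (fun f => (phi %| f)%R) (rough_squarefree k m c))%N.
Proof.
move=> /andP[ki im]; rewrite mem_monics => /andP[pm /eqP sp] ip p0.
have phi0 := irreducible_neq0 ip.
rewrite -!size_filter -(size_map (fun g => (phi * g)%R)).
apply: uniq_leq_size.
  by rewrite (map_inj_uniq (mulfI phi0)) !filter_uniq ?monics_uniq.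
move=> _ /mapP[g + ->]; rewrite !(mem_filter (fun f => _ %| _)) mem_filter.
case/andP=> npg /rough_squarefreeP[gm sg rg qg g0]; rewrite dvdp_mulIl.
apply/rough_squarefreeP; split.
- by rewrite monicMl.
- by rewrite size_mul ?monic_neq0 // sp sg addSn addnS subnKC.
- by apply: rough_poly_mul_irreducible; rewrite ?sp ?monic_neq0.
- exact: squarefree_poly_mul_irreducible.
- by rewrite coef0M g0 mulrC divfK.
Qed.

(** Pairs of an [f] on the list and an irreducible factor [phi] are counted with weight the degree
    of [phi]. Each [f] receives at most [m]; each [phi] is bounded below by
    [count_mul_irreducible]. *)
Lemma rough_squarefree_rec k m c :
  (\sum_(k.+1 <= i < m.+1)
     \sum_(phi <- monics F i | `[< irreducible_poly phi >] && (phi`_0 != 0)%R)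
        i * count (fun g => ~~ (phi %| g)%R) (rough_squarefree k (m - i) (c / phi`_0)%R)
     <= m * size (rough_squarefree k m c))%N.
Proof.
set S := rough_squarefree k m c.
pose P phi := `[< irreducible_poly phi >] && (phi`_0 != 0).
apply: (@leq_trans (\sum_(k.+1 <= i < m.+1) \sum_(phi <- monics F i | P phi)
    \sum_(f <- S | (phi %| f)%R) i)%N).
  rewrite big_nat [leqRHS]big_nat; apply: leq_sum => i /andP[ki im].
  rewrite big_seq_cond [leqRHS]big_seq_cond; apply: leq_sum => phi /and3P[pm /asboolP ip p0].
  by rewrite big_const_seq iter_addn_0 leq_mul2l count_mul_irreducible ?ki ?orbT.
have -> : (\sum_(k.+1 <= i < m.+1) \sum_(phi <- monics F i | P phi)
    \sum_(f <- S | (phi %| f)%R) i =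
   \sum_(f <- S) \sum_(phi <- flatten [seq monics F i | i <- index_iota k.+1 m.+1] |
      P phi && (phi %| f)%R) (size phi).-1)%N.
  rewrite [RHS](exchange_big_dep P) /= => [|f phi _ /andP[]//].
  rewrite big_flatten /= big_map; apply: eq_bigr => i _.
  rewrite big_seq_cond [RHS]big_seq_cond; apply: eq_bigr => phi /andP[].
  by rewrite mem_monics => /andP[_ /eqP->] Pp; apply: eq_bigl => f; rewrite Pp.
rewrite -sum1_size big_distrr /= big_seq [leqRHS]big_seq; apply: leq_sum => f.
move=> /rough_squarefreeP[fm sf _ _ _]; rewrite muln1 -[leqRHS]/(m.+1.-1) -sf.
rewrite -big_filter; apply: sum_size_irreducible_dvdp; first exact: monic_neq0.
  by rewrite filter_uniq ?flatten_monics_uniq ?iota_uniq.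
move=> phi; rewrite mem_filter => /andP[/andP[/andP[/asboolP ip _] pf]].
by move=> /flatten_mapP[i _]; rewrite mem_monics => /andP[].
Qed.

(** The quotient by [phi] is monic of degree m - 2i with prescribed constant term. The boolean
    factor makes the bound 0 if 2i > m, and for 2i = m the truncated exponent makes it 1. *)
Lemma count_rough_squarefree_dvd k i m c phi :
    phi \in monics F i -> irreducible_poly phi -> phi`_0 != 0 ->
  (count (fun g => (phi %| g)%R) (rough_squarefree k (m - i) c)
     <= (2 * i <= m) * q ^ (m - 2 * i).-1)%N.
Proof.
rewrite mem_monics => /andP[pm /eqP sp] ip p0.
have phi0 := irreducible_neq0 ip.
have [im|mi] := leqP (2 * i) m; last first.
  rewrite mul0n leqn0 eqn0Ngt -has_count; apply/hasPn => g.
  case/rough_squarefreeP=> gm sg _ _ _; apply/negP => /dvdp_leq.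
  by move=> /(_ (monic_neq0 gm)); rewrite sp sg; lia.
rewrite mul1n -size_filter.
set b := c / phi`_0.
apply: (@leq_trans (size [seq g : {poly F} <- monics F (m - 2 * i) | (g`_0 == b)%R])).
  rewrite -[leqRHS](size_map (fun g => (phi * g)%R)); apply: uniq_leq_size.
    by rewrite filter_uniq ?rough_squarefree_uniq.
  move=> f; rewrite mem_filter => /andP[/dvdpP[g ->]] /rough_squarefreeP[].
  rewrite monicMr // => gm; rewrite size_mul ?monic_neq0 // sp addnS /= => sg _ _ g0.
  apply/mapP; exists g; last by rewrite mulrC.
  rewrite mem_filter mem_monics gm /= /b -g0 coef0M mulfK // eqxx /=.
  by rewrite -[size g](addnK i) sg; apply/eqP; lia.
exact: size_monics_coef0_leq.
Qed.

Lemma size_irreducibles_leq i c : (size (irreducibles i c) <= q ^ i.-1)%N.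
Proof.
apply: leq_trans (size_monics_coef0_leq i c); apply: uniq_leq_size.
  by rewrite filter_uniq ?monics_uniq.
by move=> f; rewrite !mem_filter => /andP[/andP[_ ->]].
Qed.

(** This starts the induction in the degrees k < i <= 2k + 1. *)
Lemma irreducibles_rough_squarefree k i c :
  (k < i)%N -> (size (irreducibles i c) <= size (rough_squarefree k i c))%N.
Proof.
move=> ki; apply: uniq_leq_size; first by rewrite filter_uniq ?monics_uniq.
move=> f; rewrite !mem_filter => /andP[/andP[/asboolP irf ->] fm].
rewrite fm !andbT; move: fm; rewrite mem_monics => /andP[_ /eqP sf].
have irr_dvd u : u %| f -> size u != 1%N -> size u = i.+1.
  by move=> uf su; case: irf => _ /(_ u su uf) /eqp_size ->.
apply/andP; split; apply/asboolP.
  by move=> u uf uk; rewrite leqNgt; apply/negP => u1; move: uk; rewrite (irr_dvd u) ?gtn_eqF //; lia.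
move=> u su; apply/negP => u2; have := dvdp_leq (irreducible_neq0 irf) u2.
have uf : u %| f by apply: dvdp_trans u2; rewrite expr2 dvdp_mulIl.
have sui := irr_dvd u uf su.
have u0 : u != 0 by rewrite -size_poly_eq0 sui.
by rewrite expr2 size_mul // sui sf; lia.
Qed.

End CountRough.

(** * Squarefree polynomials and their products with rough ones *)

Definition squarefree_monics (F : finFieldType) (j : nat) : seq {poly F} :=
  [seq h : {poly F} <- monics F j | `[< squarefree_poly h >] && (h`_0 != 0)].

(** The characteristic polynomials sought: without a divisor of degree [k] there is no invariant
    k-space. *)
Definition squarefree_avoiding (F : finFieldType) (k n : nat) (c : F) : seq {poly F} :=
  [seq f : {poly F} <- monics F n |
    [&& `[< squarefree_poly f >],
        `[< forall d : {poly F}, d %| f -> size d <> k.+1 >] & f`_0 == c]].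

Section CountSquarefree.

Variable F : finFieldType.
Local Notation q := #|F|.
Implicit Types (f g h r u : {poly F}) (c : F).

Let Z j := [seq h : {poly F} <- monics F j | h`_0 != 0].
Let z j := if j is j'.+1 then (q.-1 * q ^ j')%N else 1%N.

Let size_Z j : size (Z j) = z j.
Proof.
case: j => [|j]; first by rewrite /Z /= polyseq1 /= oner_eq0.
have := count_predC (fun f : {poly F} => f`_0 == 0) (monics F j.+1).
rewrite -!size_filter size_monics_coef0 size_monics => /(canRL (addKn _)) ->.
by rewrite /= expnS -[X in (_ - X)%N]mul1n -mulnBl subn1.
Qed.

Let zS j : (0 < j)%N -> z j.+1 = (q * z j)%N.
Proof. by case: j => // j _; rewrite /z expnS; lia. Qed.

(** The sum counts pairs (u, g) with u^2 g of degree j and u nonconstant. For j >= 4 the term d = 1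
    is (q - 1) z(j-2), and shifting d turns the rest into q times the sum for j - 2, at most q
    z(j-3) = z(j-2). The total is at most q z(j-2) = z(j-1). *)
Let sum_z_leq j : (0 < j)%N -> (\sum_(1 <= d < j./2.+1) z d * z (j - 2 * d) <= z j.-1)%N.
Proof.
pose P j := (0 < j)%N -> (\sum_(1 <= d < j./2.+1) z d * z (j - 2 * d) <= z j.-1)%N.
rewrite -/(P j); elim/ltn_ind: j => -[//|[|j]] IHj _; first by rewrite big_geq.
rewrite -[j.+2./2]/(j./2.+1) -[j.+2.-1]/j.+1 big_ltn // big_add1.
have -> : (\sum_(1 <= d < j./2.+1) z d.+1 * z (j.+2 - 2 * d.+1) =
           q * \sum_(1 <= d < j./2.+1) z d * z (j - 2 * d))%N.
  rewrite big_distrr; apply: eq_big_nat => d /andP[d0 _].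
  by rewrite zS // -mulnA mulnS subnDA !subSS subn0.
rewrite muln1 !subSS subn0.
case: j IHj => [|j] IHj; first by rewrite big_geq // !muln0 addn0 /z !expn0 !muln1 leqnn.
have := IHj j.+1 (leqnSn _) isT; case: j {IHj} => [|j].
  rewrite big_geq // muln0 addn0 /z expn0 expn1 muln1 => _.
  by rewrite leq_mul2l leq_pred orbT.
have -> : z j.+3 = (q.-1 * z j.+2 + q * z j.+1)%N.
  by rewrite [z j.+3]zS // -[(q * z j.+1)%N]zS // addnC -mulSn prednK // ltnW // finNzRing_gt1.
by move=> IH; rewrite /z expn0 muln1 leq_add // leq_mul.
Qed.

(** Removing the products u^2 g leaves at least z(j) - z(j-1), which is (q - 1)^2 q^(j-2) for j >=
    2, and q <= 2 (q - 1). *)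
Lemma size_squarefree_monics j : (q ^ j <= 4 * size (squarefree_monics F j))%N.
Proof.
have q1 : (1 < q)%N := finNzRing_gt1 F.
have Zle : (z j <= size (squarefree_monics F j) + \sum_(1 <= d < j./2.+1) z d * z (j - 2 * d))%N.
  rewrite -size_Z -(count_predC (fun h => `[< squarefree_poly h >]) (Z j)) -!size_filter.
  rewrite -filter_predI; apply: leq_add => //.
  have -> : (\sum_(1 <= d < j./2.+1) z d * z (j - 2 * d) = size (flatten
     [seq [seq (u ^+ 2 * g)%R | u <- Z d, g <- Z (j - 2 * d)] | d <- index_iota 1 j./2.+1]))%N.
    rewrite size_flatten sumnE !big_map; apply: eq_bigr => d _.
    by rewrite size_allpairs !size_Z.
  apply: uniq_leq_size; first by rewrite !filter_uniq ?monics_uniq.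
  move=> h; rewrite !mem_filter mem_monics => /and3P[/= /asboolPn nsh h0 /andP[hm /eqP sh]].
  have hn0 := monic_neq0 hm.
  have /existsPNP[u su /negP/negPn u2] := nsh.
  have u0 : u != 0 by apply: contraNneq hn0 => u0; rewrite u0 expr0n dvd0p in u2.
  have lu0 : (lead_coef u)^-1 != 0 by rewrite invr_eq0 lead_coef_eq0.
  pose v := (lead_coef u)^-1 *: u.
  have vm : v \is monic by rewrite monicE lead_coefZ mulVf // lead_coef_eq0.
  have sv : (1 < size v)%N by rewrite size_scale // size_neq1_gt1.
  have /dvdpP[g Dh] : v ^+ 2 %| h by rewrite exprZn dvdpZl ?expf_neq0.
  have gm : g \is monic by move: hm; rewrite Dh monicMr // monic_exp.
  have v0 := monic_neq0 vm; have g0 := monic_neq0 gm.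
  have sgv : (size g + 2 * (size v).-1 = j.+1)%N.
    move: sh; rewrite Dh expr2 !size_mul ?mulf_neq0 //.
    by move: (size g) (size v) sv; clear => a b; lia.
  move: h0; rewrite Dh !(coef0M, expr2) !mulf_eq0 !negb_or => /and3P[g00 v00 _].
  have sg : (0 < size g)%N by rewrite size_poly_gt0.
  apply/flatten_mapP; exists (size v).-1.
    by rewrite mem_index_iota; move: (size g) (size v) sv sgv sg; clear => a b; lia.
  apply/allpairsP; exists (v, g); rewrite /= mulrC; split=> //.
    by rewrite mem_filter v00 mem_monics vm prednK ?eqxx // ltnW.
  rewrite mem_filter g00 mem_monics gm /=; apply/eqP.
  by move: (size g) (size v) sv sgv sg; clear => a b; lia.
case: j Zle => [|j] Zle; first by move: Zle; rewrite big_geq //= addn0; lia.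
case: j Zle => [|j] Zle.
  by move: Zle; rewrite big_geq //= addn0 !expn0 expn1 muln1; move: #|F| (size _) q1 => a b; lia.
have := leq_trans Zle (leq_add (leqnn _) (sum_z_leq (ltn0Sn j.+1))); rewrite /z /=.
move=> le; have qq : (q * q <= 4 * (q.-1 * q.-1))%N by move: #|F| q1 => a; nia.
have := leq_mul qq (leqnn (q ^ j)); rewrite -!mulnA -!expnS => /leq_trans; apply.
have eq1 : (q.-1 * q ^ j.+1 = q.-1 * q.-1 * q ^ j + q.-1 * q ^ j)%N.
  by rewrite -mulnA -mulnDr -mulSnr prednK ?expnS // ltnW.
by rewrite leq_mul2l /=; move: le; rewrite eq1 leq_add2r -!mulnA.
Qed.

Lemma size_squarefree_monics0 : size (squarefree_monics F 0) = 1%N.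
Proof.
rewrite /squarefree_monics /= polyseq1 oner_eq0 andbT.
by rewrite asboolT //; exact: squarefree_poly1.
Qed.

(** The products [h * r] belong to the list by [squarefree_poly_mul_rough] and
    [size_dvdp_mul_rough], and are distinct by [rough_factorization_inj]. *)
Lemma sum_rough_squarefree_leq k n c : (2 * k <= n)%N ->
  (\sum_(j < k) \sum_(h <- squarefree_monics F j)
      size (rough_squarefree k (n - j) (c / h`_0)%R)
     <= size (squarefree_avoiding k n c))%N.
Proof.
move=> kn; pose H := flatten [seq squarefree_monics F j | j <- iota 0 k].
have memH h : h \in H ->
    [/\ h \is monic, (0 < size h <= k)%N, squarefree_poly h & h`_0 != 0].
  case/flatten_mapP=> j; rewrite mem_iota => /andP[_ jk].
  rewrite mem_filter mem_monics => /andP[/andP[/asboolP qh h0] /andP[hm /eqP sh]].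
  by rewrite sh.
pose t h := rough_squarefree k (n - (size h).-1) (c / h`_0).
have -> : (\sum_(j < k) \sum_(h <- squarefree_monics F j)
    size (rough_squarefree k (n - j) (c / h`_0)%R)
      = size [seq (h * r)%R | h <- H, r <- t h])%N.
  rewrite size_allpairs_dep sumnE big_map big_flatten big_map /=.
  rewrite -(big_mkord predT (fun j => \sum_(h <- squarefree_monics F j) size
    (rough_squarefree k (n - j) (c / h`_0)%R))%N) /index_iota subn0.
  apply: eq_bigr => j _; rewrite big_seq [RHS]big_seq; apply: eq_bigr => h.
  by rewrite mem_filter mem_monics /t => /andP[_ /andP[_ /eqP ->]].
apply: uniq_leq_size.
  apply: allpairs_uniq_dep => [|h _|]; last 1 first.
  - move=> _ _ /allpairsPdep[h [r [Hh tr ->]]] /allpairsPdep[h' [r' [Hh' tr' ->]]] /= e.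
    have [hm /andP[_ hk] _ _] := memH h Hh; have [hm' /andP[_ hk'] _ _] := memH h' Hh'.
    have [_ _ rr _ _] := rough_squarefreeP _ _ _ _ tr.
    have [_ _ rr' _ _] := rough_squarefreeP _ _ _ _ tr'.
    by have [-> ->] := rough_factorization_inj hm hm' hk hk' rr rr' e.
  - have -> : H = [seq h : {poly F} <- flatten [seq monics F j | j <- iota 0 k] |
                    `[< squarefree_poly h >] && (h`_0 != 0)].
      by rewrite filter_flatten -map_comp.
    by rewrite filter_uniq ?flatten_monics_uniq ?iota_uniq.
  exact: rough_squarefree_uniq.
move=> _ /allpairsPdep[h [r [/memH[hm /andP[sh0 shk] qh h0] /rough_squarefreeP[rm sr rr qr r0] ->]]].
have hn0 := monic_neq0 hm.
rewrite mem_filter mem_monics monicMl // rm size_mul ?monic_neq0 // sr.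
apply/andP; split; last first.
  by apply/eqP; move: (size h) sh0 shk {sr} => a; lia.
apply/and3P; split.
- by apply/asboolP; apply: squarefree_poly_mul_rough rr; rewrite // leqW.
- by apply/asboolP => d; apply: size_dvdp_mul_rough.
- by rewrite coef0M r0 mulrC divfK.
Qed.

End CountSquarefree.

(** * The recursion, grouped by constant terms *)

Section Recursion.

Variable F : finFieldType.
Local Notation q := #|F|.
Implicit Types (f g h r phi : {poly F}) (b c : F).

Lemma sum_irreducibles i (G : F -> nat) :
  (\sum_(phi <- monics F i | `[< irreducible_poly phi >] && (phi`_0 != 0)%R) G (phi`_0)%R
     = \sum_(b | b != 0%R) size (irreducibles i b) * G b)%N.
Proof.
rewrite (partition_big (fun phi : {poly F} => phi`_0) (fun b => b != 0)) /= => [|phi /andP[]//].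
apply: eq_bigr => b b0; rewrite -sum1_size big_distrl big_filter /=.
have eqc phi : `[< irreducible_poly phi >] && (phi`_0 != 0) && (phi`_0 == b)
    = `[< irreducible_poly phi >] && (phi`_0 == b).
  by rewrite -andbA; congr (_ && _); case: (phi`_0 =P b) => [->|]; rewrite ?b0 ?andbF.
by rewrite (eq_bigl _ _ eqc); apply: eq_bigr => phi /andP[_ /eqP->]; rewrite mul1n.
Qed.

(** In the range k < i < m - k the cofactor has degree greater than k, so that induction applies;
    for i = m it is 1. The last sum pays for the cofactors divisible by phi. *)
Lemma rough_squarefree_rec_bound k m c : c != 0 -> (2 * k + 2 <= m)%N ->
  (\sum_(k.+1 <= i < m - k) \sum_(b | b != 0%R)
      size (irreducibles i b) * (i * size (rough_squarefree k (m - i) (c / b)%R))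
     + m * size (irreducibles m c)
   <= m * size (rough_squarefree k m c)
     + \sum_(k.+1 <= i < m./2.+1) i * (q.-1 * q ^ i.-1) * q ^ (m - 2 * i).-1)%N.
Proof.
move=> c0 km.
pose P phi := `[< irreducible_poly phi >] && (phi`_0 != 0).
pose nd phi g := ~~ (phi %| g).
pose A i := (\sum_(phi <- monics F i | P phi)
  i * count (nd phi) (rough_squarefree k (m - i) (c / phi`_0)%R))%N.
have recA : (\sum_(k.+1 <= i < m - k) A i + A m <= m * size (rough_squarefree k m c))%N.
  apply: leq_trans (rough_squarefree_rec k m c).
  rewrite [leqRHS](@big_cat_nat _ _ _ (m - k)) /=; [|lia|lia].
  (* For m - k <= i < m the cofactor would have degree between 1 and k and is never rough, so
     dropping these terms costs nothing. *)
  rewrite leq_add2l big_nat_recr /=; last by lia.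
  by rewrite leq_addl.
have Am : (m * size (irreducibles m c) <= A m)%N.
  rewrite -sum1_size big_distrr /= big_filter big_mkcond [leqRHS]big_mkcond /=.
  rewrite big_seq [leqRHS]big_seq; apply: leq_sum => phi pm.
  case: ifP => // /andP[ip /eqP p0]; rewrite /P ip p0 c0 /= muln1 divff //.
  rewrite -[leqLHS]muln1 leq_mul2l subnn -size_filter.
  have -> : rough_squarefree k 0 1 = [:: 1 : {poly F}].
    rewrite /rough_squarefree /= polyseq1 eqxx andbT !asboolT //.
      exact: squarefree_poly1.
    by move=> d; rewrite dvdp1 => /eqP->.
  by rewrite /= /nd dvdp1; move/asboolP: ip => [s1 _]; rewrite (gtn_eqF s1) orbT.
pose C i := (i * (q.-1 * q ^ i.-1) * q ^ (m - 2 * i).-1)%N.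
have stepA i :
    (\sum_(b | b != 0%R)
      size (irreducibles i b) * (i * size (rough_squarefree k (m - i) (c / b)%R))
     <= A i + (2 * i <= m) * C i)%N.
  rewrite -(sum_irreducibles i (fun b => i * size (rough_squarefree k (m - i) (c / b)%R))%N).
  apply: (@leq_trans (A i + \sum_(phi <- monics F i | P phi)
      i * ((2 * i <= m) * q ^ (m - 2 * i).-1))%N).
    rewrite -big_split /= big_seq_cond [leqRHS]big_seq_cond.
    apply: leq_sum => phi /and3P[pm /asboolP ip p0].
    rewrite -mulnDr leq_mul2l -(count_predC (nd phi)) leq_add2l.
    apply/orP; right; apply: leq_trans (count_rough_squarefree_dvd _ _ _ pm ip p0).
    by apply: eq_leq; apply: eq_count => g; rewrite /= negbK.
  rewrite leq_add2l (sum_irreducibles i (fun=> (i * ((2 * i <= m) * q ^ (m - 2 * i).-1))%N)).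
  rewrite -big_distrl /=.
  (* The crude bound q^(i-1) for each of the q - 1 constant terms suffices here. *)
  apply: (@leq_trans (q.-1 * q ^ i.-1 * (i * ((2 * i <= m) * q ^ (m - 2 * i).-1)))%N).
    rewrite leq_mul2r; apply/orP; right.
    rewrite -(cardC1 (0 : F)) -sum_nat_const /=.
    by apply: leq_sum => b _; exact: size_irreducibles_leq.
  by rewrite /C; apply: eq_leq; ring.
apply: (@leq_trans (\sum_(k.+1 <= i < m - k) (A i + (2 * i <= m) * C i) + A m)%N).
  by apply: leq_add Am; apply: leq_sum => i _; exact: stepA.
rewrite big_split /= addnAC leq_add //.
rewrite [leqRHS](big_nat_widen _ _ (m - k)); last by lia.
rewrite [leqRHS]big_mkcond; apply: eq_leq; apply: eq_bigr => i _ /=.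
have -> : (2 * i <= m)%N = (i < m./2.+1)%N by apply/idP/idP; lia.
by case: ifP; rewrite ?mul1n.
Qed.

End Recursion.

(** * Solving the recursion *)

Section NumericalBounds.

Variables (R : realFieldType) (x : R).
Hypotheses (x_gt0 : 0 < x) (x_le : x <= 1 / 2).

(* With x = 1 / q, i times the number of irreducible polynomials of degree i with
   a given nonzero constant term is at least q^i (1 - irr_defect i) / (q - 1). *)
Definition irr_defect (i : nat) : R := x ^+ (uphalf i).-1 - x ^+ i.-1.
(* The products phi g with phi irreducible of degree i dividing g contribute at
   most q^m (square_defect i) / (q - 1) to the recursion if 2 i < m; the last
   term of [recursion_defect] is their contribution when 2 i = m. *)
Definition square_defect (i : nat) : R := i%:R * (1 - x) ^+ 2 * x ^+ i.
(** The closed form of the series of [square_defect] from index [i] on. *)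
Definition square_tail (i : nat) : R := i%:R * x ^+ i - (i%:R - 1) * x ^+ i.+1.

Let x_le1 : x <= 1. Proof. by move: x_le => ?; lra. Qed.

Let expx_ge0 i : 0 <= x ^+ i.
Proof. by rewrite exprn_ge0 // ltW. Qed.

Let expx_le i j : (i <= j)%N -> x ^+ j <= x ^+ i.
Proof. by move=> ij; exact: ler_wiXn2l (ltW x_gt0) x_le1 _ _ ij. Qed.

Lemma irr_defect_ge0 i : (0 < i)%N -> 0 <= irr_defect i.
Proof. by move=> i0; rewrite subr_ge0 expx_le //; lia. Qed.

(** The indices 2l + 3 and 2l + 4 contribute at most x^(l+1) each, and index 2 gives 1 - x. The
    resulting bound 1 - x + 2x / (1 - x) reaches 5/2 at x = 1/2. *)
Lemma sum_irr_defect_le a b : (1 < a)%N -> \sum_(a <= i < b) irr_defect i <= 5 / 2.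
Proof.
have [x0 xh] := (x_gt0, x_le).
move=> a1; have sub l : \sum_(3 <= i < 3 + l.*2) irr_defect i * (1 - x) <= 2 * x * (1 - x ^+ l).
  elim: l => [|l IHl]; first by rewrite big_geq // expr0 subrr mulr0.
  rewrite doubleS !addnS big_nat_recr /= 1?leqW ?leq_addr // big_nat_recr ?leq_addr //=.
  have e1 : irr_defect (3 + l.*2) <= x ^+ l.+1.
    by rewrite /irr_defect lerBlDr (_ : (uphalf (3 + l.*2)).-1 = l.+1) ?lerDl //; lia.
  have e2 : irr_defect (3 + l.*2).+1 <= x ^+ l.+1.
    by rewrite /irr_defect lerBlDr (_ : (uphalf (3 + l.*2).+1).-1 = l.+1) ?lerDl //; lia.
  have x1 : 0 <= 1 - x by lra.
  move: (ler_wpM2r x1 (lerD e1 e2)) IHl; rewrite exprS; move: (x ^+ l) => y ? ?; lra.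
have ge0 c d : (0 < c)%N -> 0 <= \sum_(c <= i < d) irr_defect i.
  move=> c0; rewrite big_nat; apply: sumr_ge0 => i /andP[ci _].
  exact: irr_defect_ge0 (leq_trans c0 ci).
have [ba|ab] := leqP b a; first by rewrite big_geq //; lra.
have le : \sum_(a <= i < b) irr_defect i <= \sum_(2 <= i < 3 + b.*2) irr_defect i.
  rewrite [leRHS](@big_cat_nat _ _ _ a) /=; [|lia|lia].
  rewrite [X in _ + X](@big_cat_nat _ _ _ b) /=; [|lia|lia].
  have g1 := ge0 2%N a isT; have g2 := ge0 b (3 + b.*2)%N (leq_ltn_trans (leq0n _) ab); lra.
apply: le_trans le _; rewrite big_ltn; last by lia.
have := sub b; rewrite -mulr_suml; set S := \sum_(3 <= i < _) _ => leS.
have -> : irr_defect 2 = 1 - x by rewrite /irr_defect expr0 expr1.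
have x1 : 0 < 1 - x by lra.
have := expx_ge0 b; move: (x ^+ b) leS => y leS y0.
rewrite -(ler_pM2r x1); nra.
Qed.

Lemma sum_square_defect a b : (0 < a <= b)%N ->
  \sum_(a <= i < b) square_defect i = square_tail a - square_tail b.
Proof.
have [x0 xh] := (x_gt0, x_le).
move=> /andP[a0 ab]; rewrite -opprB -telescope_sumr // -sumrN; apply: eq_bigr => i _.
by rewrite /square_defect /square_tail -natr1 !exprS; ring.
Qed.

Lemma square_tail_ge0 i : (0 < i)%N -> 0 <= square_tail i.
Proof.
have [x0 xh] := (x_gt0, x_le).
case: i => // i _; rewrite /square_tail -natr1 !exprS.
have := ler0n R i; have := expx_ge0 i; move: (x ^+ i) (i%:R) => y n y0 n0.
have -> : (n + 1) * (x * y) - (n + 1 - 1) * (x * (x * y)) = x * y * (1 + n * (1 - x)) by ring.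
by rewrite mulr_ge0 ?mulr_ge0 ?addr_ge0 ?mulr_ge0 ?(ltW x_gt0) //; lra.
Qed.

Lemma square_tail_le a b : (0 < a <= b)%N -> square_tail b <= square_tail a.
Proof.
have [x0 xh] := (x_gt0, x_le).
move=> ab; rewrite -subr_ge0 -sum_square_defect //; apply: sumr_ge0 => i _.
by rewrite /square_defect !mulr_ge0 ?ler0n ?expx_ge0 // subr_ge0.
Qed.

(** The left side decreases in [j], because x (j + 1) <= j for x <= 1/2 and j >= 1. *)
Let geom_le (y : R) j : 0 <= y -> (3 <= j)%N ->
  x ^+ j.-1 * (1 + j%:R * y) <= x ^+ 2 * (1 + 3 * y).
Proof.
have [x0 xh] := (x_gt0, x_le).
move=> y0; case: j => // j; elim: j => // j IHj; rewrite leq_eqVlt => /predU1P[[<-]|] //.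
move=> j2; apply: le_trans (IHj _); last by [].
have j0 : (0 < j)%N by lia.
rewrite -[j.+2.-1](prednK (ltn0Sn j)) /= exprS mulrAC [leRHS]mulrC; apply: ler_wpM2r => //.
have j1 : 1 <= j%:R :> R by rewrite ler1n.
rewrite -[j.+2%:R]natr1 -!natr1; move: (j%:R) j1 => n n1.
have h : x * (n + 1 + 1) <= n + 1 by nra.
have := ler_wpM2l y0 h => h'; lra.
Qed.

(** The relative loss from the term i = m and from repeated factors. For even m the index m/2 stands
    apart: truncation of the exponent makes its contribution 1/x times [square_defect]. *)
Definition recursion_defect (k m : nat) : R :=
  irr_defect m + \sum_(k.+1 <= i < uphalf m) square_defect i
  + (if odd m then 0 else m./2%:R * (1 - x) ^+ 2 * x ^+ m./2.-1).

Let recursion_defect_odd k j : (k < j)%N ->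
  recursion_defect k (2 * j).+1 <= square_tail k.+1 + x ^+ j.
Proof.
move=> kj; rewrite /recursion_defect /irr_defect.
have -> : uphalf (2 * j).+1 = j.+1 by lia.
have -> : odd (2 * j).+1 by lia.
rewrite sum_square_defect ?ltnS ?(ltnW kj) //= addr0.
by have := square_tail_ge0 (ltn0Sn j) => t; have := expx_ge0 (2 * j) => e; lra.
Qed.

Let recursion_defect_even k j : (k <= j)%N ->
  recursion_defect k (2 * j.+1) = square_tail k.+1 - square_tail j.+1
    + x ^+ j - x ^+ (2 * j).+1 + j.+1%:R * (1 - x) ^+ 2 * x ^+ j.
Proof.
move=> kj; rewrite /recursion_defect /irr_defect.
have -> : uphalf (2 * j.+1) = j.+1 by lia.
have -> : odd (2 * j.+1) = false by lia.
have -> : (2 * j.+1)./2 = j.+1 by lia.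
have -> : (2 * j.+1).-1 = (2 * j).+1 by lia.
by rewrite sum_square_defect ?ltnS ?kj //=; ring.
Qed.

(** Beyond [square_tail k.+1] the defect is at most x^j (1 + (j + 1) (1 - x) (1 - 2x)), which
    [geom_le] bounds by its value at j = 2. *)
Let recursion_defect_even_le k j : (k <= j)%N -> (2 <= j)%N ->
  recursion_defect k (2 * j.+1)
    <= square_tail k.+1 + x ^+ 2 * (1 + 3 * ((1 - x) * (1 - 2 * x))).
Proof.
have [x0 xh] := (x_gt0, x_le); move=> kj j2; rewrite recursion_defect_even //.
have y0 : 0 <= (1 - x) * (1 - 2 * x) by rewrite mulr_ge0 //; lra.
apply: le_trans (lerD (lexx _) (geom_le (j := j.+1) y0 _)); last by [].
have e1 := expx_ge0 (2 * j).+1; have e2 := expx_ge0 j.+2.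
rewrite /square_tail -!natr1 !exprS /= in e1 e2 *.
move: (x ^+ j) (j%:R) (x ^+ (2 * j)) e1 e2 => y n z e1 e2; lra.
Qed.

Let square_tail2 : square_tail 2 = 2 * x ^+ 2 - x ^+ 3.
Proof. by rewrite /square_tail; ring. Qed.

Let square_tail3 : square_tail 3 = 3 * x ^+ 3 - 2 * x ^+ 4.
Proof. by rewrite /square_tail; ring. Qed.

(** This closes the induction on m. The fraction is the loss from the 2k + 1 indices outside k < i <
    m - k and from [sum_irr_defect_le], scaled by the constant 1 / (4 (k + 3)). It is 11/32 for k =
    1 and at most 1/2 otherwise. *)
Lemma recursion_defect_le k m : (0 < k)%N -> (2 * k + 2 <= m)%N ->
  recursion_defect k m + (2 * k%:R + 1 + 5 / 2) / (4 * (k%:R + 3)) <= 1.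
Proof.
have [x0 xh] := (x_gt0, x_le).
move=> k0 km.
have [k_eq1|k_ge2] : k = 1%N \/ (2 <= k)%N by case: k k0 {km} => [|[|k]] // _; [left|right].
- have -> : (2 * k%:R + 1 + 5 / 2) / (4 * (k%:R + 3)) = 11 / 32 :> R by rewrite k_eq1; field.
  suff : recursion_defect k m <= 21 / 32 by move=> ?; lra.
  rewrite k_eq1 in km *.
  have [->|[j j2 [->|->]]] :
      m = (2 * 2)%N \/ exists2 j, (2 <= j)%N & m = (2 * j).+1 \/ m = (2 * j.+1)%N.
    have [m4|m5] : m = 4%N \/ (5 <= m)%N by lia.
      by left.
    by right; exists (uphalf m).-1; lia.
  + rewrite recursion_defect_even //.
    have -> : square_tail 2 - square_tail 2 + x ^+ 1 - x ^+ (2 * 1).+1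
        + 2 * (1 - x) ^+ 2 * x ^+ 1 = 3 * x - 4 * x ^+ 2 + x ^+ 3 by ring.
    (* Replacing x^3 by x^2 / 2 leaves 3x - 7x^2 / 2, whose maximum 9/14, at x = 3/7, is below
       21/32. *)
    have h1 : 0 <= x ^+ 2 * (1 / 2 - x) by rewrite mulr_ge0 //; lra.
    by have := sqr_ge0 (x - 3 / 7) => h2; lra.
  + have l1 := recursion_defect_odd (k := 1) j2; have l2 := expx_le j2.
    rewrite square_tail2 in l1.
    (* The defect is at most 3x^2 - x^3; the product below is 5/8 minus this. *)
    have h : 0 <= (1 / 2 - x) * (5 / 4 + 5 / 2 * x - x ^+ 2) by rewrite mulr_ge0; nra.
    by lra.
  have l1 := recursion_defect_even_le (k := 1) (ltnW j2) j2; rewrite square_tail2 in l1.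
  have h : 0 <= (1 / 2 - x) * (5 / 4 + 5 / 2 * x - 7 * x ^+ 2) by rewrite mulr_ge0; nra.
  have h2 : 0 <= x ^+ 3 * (1 / 2 - x) by rewrite mulr_ge0 //; lra.
  by lra.
have kr : 2 <= k%:R :> R by rewrite (ler_nat _ 2).
have lamb : (2 * k%:R + 1 + 5 / 2) / (4 * (k%:R + 3)) <= 1 / 2 :> R.
  by rewrite ler_pdivrMr; lra.
suff : recursion_defect k m <= 1 / 2 by move=> ?; lra.
(* By monotonicity of the tail, k = 2 is the worst of the remaining cases. *)
have tk : square_tail k.+1 <= 3 * x ^+ 3 - 2 * x ^+ 4 by rewrite -square_tail3 square_tail_le.
have x1 : 0 <= 1 / 2 - x by lra.
have [[j kj ->]|[j kj ->]] : (exists2 j, (k < j)%N & m = (2 * j).+1)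
    \/ (exists2 j, (k <= j)%N & m = (2 * j.+1)%N).
  have [om|om] := boolP (odd m); [left|right]; exists (uphalf m).-1;
    move: om km; clear; lia.
- have l1 := recursion_defect_odd kj; have l2 := expx_le (leq_ltn_trans k_ge2 kj).
  have h : 0 <= x ^+ 2 * (1 / 2 - x) by rewrite mulr_ge0.
  have h4 := expx_ge0 4; have := sqr_ge0 x; nra.
have l1 := recursion_defect_even_le kj (leq_trans k_ge2 kj).
have h : 0 <= (1 / 2 - x) * (1 + 2 * x - 4 * x ^+ 2 + 4 * x ^+ 3).
  rewrite mulr_ge0 //; have := expx_ge0 3; nra.
by lra.
Qed.

End NumericalBounds.

(** For the case k = 1, m = 2 of the induction, with y = q: it amounts to y^2 <= 8 (y - 1)^2. *)
Lemma sqr_le_8mul (R : realFieldType) (y N : R) :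
  2 <= y -> y - 1 <= 2 * N -> y ^+ 2 <= 16 * ((y - 1) * N).
Proof.
move=> y2 yN; have y1 : 0 <= y - 1 by lra.
have := ler_wpM2l y1 yN => h.
have : 0 <= (y - 2) * (7 * y - 2) by rewrite mulr_ge0; lra.
by move=> ?; lra.
Qed.

(** The linear arithmetic of the inductive step, with W = q^m and lam = 1 / (4 (k + 3)). Up to the
    factor q - 1, [A1] and [A2] are the recursion terms for i < m and i = m, [A3] is m T_m(c), and
    [A4] is the correction for repeated factors. *)
Lemma recursion_step_arith (R : realFieldType) (m k W lam A1 A2 A3 A4 e r : R) :
    W * lam * (m - (2 * k + 1 + 5 / 2)) <= A1 -> A1 + A2 <= A3 + A4 ->
    W * r + W * ((2 * k + 1 + 5 / 2) * lam) <= W -> W * (1 - e) <= A2 ->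
    A4 + W * e = W * r ->
  W * lam * m <= A3.
Proof. by move=> h1 h2 h3 h4 h5; lra. Qed.

(** * Lower bounds for the numbers of polynomials *)

Section CountLowerBound.

Variable F : finFieldType.
Local Notation q := #|F|.
Implicit Types (b c : F) (k m i : nat).

Let q_gt1 : (1 < q)%N := finNzRing_gt1 F.

(** This is [card_irreducibles] times q - 1: the sum of powers becomes q^i - 1, and the bad roots
    cost at most q^(i/2+1) - q - 1, with i/2 rounded down. *)
Lemma irreducibles_lower_bound i b : b != 0 -> (1 < i)%N ->
  (q ^ i + q <= q.-1 * (i * size (irreducibles i b)) + q ^ i./2.+1)%N.
Proof.
move=> b0 i1; have [B [leB B_le _]] := card_irreducibles (ltnW i1) b0.
have sumB l : (q.-1 * \sum_(1 <= e < l.+2) (q ^ e).-1 + q.+1 <= q ^ l.+2)%N.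
  elim: l => [|l IHl]; first by rewrite big_nat1 expn1 expnS expn1; move: #|F| q_gt1 => n; nia.
  rewrite big_nat_recr //= mulnDr addnAC [(q ^ l.+3)%N]expnS.
  rewrite -[X in (X * q ^ l.+2)%N](prednK (ltnW q_gt1)).
  rewrite mulSn leq_add // leq_mul2l leq_pred; exact: orbT.
have := sumB i./2.-1; rewrite (_ : i./2.-1.+2 = i./2.+1); last by lia.
have := leq_mul (leqnn q.-1) leB; rewrite -predn_exp mulnDr.
have := leq_mul (leqnn q.-1) B_le.
have : (0 < q ^ i)%N by rewrite expn_gt0 ltnW.
move: (q.-1 * B)%N (q.-1 * (i * _))%N => a1 a2.
move: (q.-1 * _)%N => a3; move: (q ^ i)%N (q ^ i./2.+1)%N => a4 a5; move: #|F| => n; lia.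
Qed.

(** In degree 2 the general bound yields only q / (q - 1) on the left, so the limit of two bad roots
    is used. *)
Lemma irreducibles2_lower_bound b : b != 0 -> (q.-1 <= 2 * size (irreducibles 2 b))%N.
Proof.
move=> b0; have [B [leB _ /(_ erefl) B2]] := card_irreducibles (isT : 0 < 2)%N b0.
move: leB; rewrite big_ord_recl big_ord1 expn0 expn1; lia.
Qed.

Let Q : rat := q%:R.
Let x : rat := Q^-1.

Let Q_gt0 : 0 < Q. Proof. by rewrite ltr0n ltnW. Qed.
Let x_gt0 : 0 < x. Proof. by rewrite invr_gt0. Qed.
Let x_le : x <= 1 / 2.
Proof. by rewrite mul1r lef_pV2 ?posrE // /Q (ler_nat _ 2). Qed.
Let half_le1 : 1 / 2 <= 1 :> rat. Proof. by []. Qed.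
Let natr_pred_card : (q.-1)%:R = Q - 1. Proof. by rewrite -subn1 natrB // ltnW. Qed.
Let Qx : Q * x = 1. Proof. by rewrite divff // gt_eqF. Qed.
Let Qexp m i : (i <= m)%N -> Q ^+ (m - i) = Q ^+ m * x ^+ i.
Proof. by move=> im; rewrite exprVn expfB_cond ?gt_eqF. Qed.

Lemma irreducibles_lower_boundr i b : b != 0 -> (1 < i)%N ->
  Q ^+ i * (1 - irr_defect x i) <= (Q - 1) * (i * size (irreducibles i b))%:R.
Proof.
move=> b0 i1; have := irreducibles_lower_bound b0 i1.
rewrite -(ler_nat rat) !natrD !natrM natr_pred_card !natrX -/Q => le.
rewrite /irr_defect mulrBr mulrBr mulr1 -!Qexp; [|lia|lia].
have -> : (i - (uphalf i).-1 = i./2.+1)%N by lia.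
have -> : (i - i.-1 = 1)%N by lia.
by rewrite expr1; lra.
Qed.

Let square_defect_corr k m : (0 < k)%N -> (2 * k + 2 <= m)%N ->
  (Q - 1) * (\sum_(k.+1 <= i < m./2.+1) i * (q.-1 * q ^ i.-1) * q ^ (m - 2 * i).-1)%:R
   + Q ^+ m * irr_defect x m = Q ^+ m * recursion_defect x k m.
Proof.
move=> k0 km; rewrite /recursion_defect -addrA [RHS]mulrDr [LHS]addrC; congr (_ + _).
pose C i : rat := (i * (q.-1 * q ^ i.-1) * q ^ (m - 2 * i).-1)%:R.
have QE : Q - 1 = Q * (1 - x) by rewrite mulrBr Qx mulr1.
have CE i : (Q - 1) * C i = i%:R * (1 - x) ^+ 2 * (Q ^+ 2 * Q ^+ i.-1 * Q ^+ (m - 2 * i).-1).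
  by rewrite /C !natrM natr_pred_card !natrX QE; ring.
have Cs i : (k.+1 <= i < uphalf m)%N -> (Q - 1) * C i = Q ^+ m * square_defect x i.
  move=> im; rewrite CE -!exprD /square_defect [RHS]mulrCA -Qexp; last by lia.
  by congr (_ * Q ^+ _); lia.
rewrite natr_sum mulr_sumr.
have [om|em] := boolP (odd m).
  have -> : m./2.+1 = uphalf m by lia.
  by rewrite addr0 mulr_sumr; apply: eq_big_nat.
have -> : m./2.+1 = (uphalf m).+1 by lia.
(* For i = m/2 the exponent [(m - 2 * i).-1] is 0 instead of -1, whence the separate last term of
   [recursion_defect]. *)
rewrite big_nat_recr /=; last by lia.
rewrite mulrDr; congr (_ + _); first by rewrite mulr_sumr; apply: eq_big_nat.
rewrite -/(C _) CE -!exprD [RHS]mulrCA -Qexp; last by lia.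
have -> : uphalf m = m./2 by lia.
by congr (_ * Q ^+ _); lia.
Qed.

(** Strong induction on [m]. Up to 2k + 1 the irreducible polynomials alone suffice; beyond, the
    recursion refers to degrees between k + 1 and m - k - 1. *)
Theorem rough_squarefree_lower_bound k m c :
    (0 < k)%N -> (k < m)%N -> c != 0 ->
  Q ^+ m / (4 * (k%:R + 3)) <= (Q - 1) * (size (rough_squarefree k m c))%:R.
Proof.
move=> k0; elim/ltn_ind: m c => m IHm c km c0.
have k1 : 1 <= k%:R :> rat by rewrite ler1n.
have lam_gt0 : 0 < 4 * (k%:R + 3) :> rat by lra.
have Q1 : 0 < Q - 1 by rewrite subr_gt0 (ltr_nat _ 1).
have Qm : 0 < Q ^+ m by rewrite exprn_gt0.
have m0 : 0 < m%:R :> rat by rewrite ltr0n (leq_ltn_trans _ km).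
have [mk|km2] := ltnP m (2 * k + 2).
  have N_le : (size (irreducibles m c))%:R <= (size (rough_squarefree k m c))%:R :> rat.
    by rewrite ler_nat irreducibles_rough_squarefree.
  apply: le_trans (ler_wpM2l (ltW Q1) N_le); rewrite ler_pdivrMr //.
  have [m2|m3] : m = 2 \/ (2 < m)%N by move: k0 km; clear; lia.
    have -> : k = 1%N by move: k0 km m2; clear; lia.
    have := irreducibles2_lower_bound c0.
    rewrite -(ler_nat rat) natrM natr_pred_card m2 => le2.
    have Q2 : 2 <= Q by rewrite (ler_nat _ 2).
    by apply: le_trans (sqr_le_8mul Q2 le2) _; rewrite le_eqVlt; apply/orP; left; apply/eqP; ring.
  have le1 := irreducibles_lower_boundr c0 (leq_ltn_trans k0 km).
  (* From degree 3 on at least half of the main term survives, and m <= 2k + 1 is below half of 4 (k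
     + 3). *)
  have dm : irr_defect x m <= 1 / 2.
    rewrite /irr_defect lerBlDr (le_trans (y := x ^+ 1)) //.
      apply: ler_wiXn2l; [exact: ltW x_gt0 | exact: le_trans x_le half_le1 |].
      by move: m3; clear; lia.
    by rewrite expr1; apply: le_trans x_le _; rewrite lerDl exprn_ge0 // (ltW x_gt0).
  have mk' : m%:R <= 2 * k%:R + 1 :> rat by rewrite -natrM natr1 ler_nat; move: mk; clear; lia.
  rewrite natrM in le1.
  have : Q ^+ m * (1 / 2) <= (Q - 1) * (m%:R * (size (irreducibles m c))%:R).
    by apply: le_trans le1; apply: (ler_wpM2l (ltW Qm)); lra.
  move: ((size _)%:R) => N leN; rewrite -(ler_pM2r m0).
  have -> : (Q - 1) * N * (4 * (k%:R + 3)) * m%:R = (Q - 1) * (m%:R * N) * (4 * (k%:R + 3)) by ring.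
  apply: le_trans (ler_wpM2r (ltW lam_gt0) leN).
  rewrite (_ : _ * (4 * _) = Q ^+ m * (2 * k%:R + 6)); last by field.
  by rewrite ler_pM2l //; lra.
set lam := (4 * (k%:R + 3))^-1.
have lam0 : 0 < lam by rewrite invr_gt0.
have := rough_squarefree_rec_bound c0 km2.
rewrite -(ler_nat rat) !natrD natr_sum => rec.
have low : Q ^+ m * lam * (\sum_(k.+1 <= i < m - k) (1 - irr_defect x i))
   <= (Q - 1) * \sum_(k.+1 <= i < m - k) (\sum_(b | b != 0)
      size (irreducibles i b) * (i * size (rough_squarefree k (m - i) (c / b)%R)))%:R.
  rewrite !mulr_sumr big_nat [leRHS]big_nat; apply: ler_sum => i /andP[ki im].
  rewrite natr_sum mulr_sumr.
  have one : \sum_(b : F | b != 0) (1 : rat) = Q - 1.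
    by rewrite sumr_const cardC1 natr_pred_card.
  (* The left side is spread evenly over the q - 1 values of b and then compared term by term. *)
  have -> : Q ^+ m * lam * (1 - irr_defect x i) =
      \sum_(b : F | b != 0) (Q - 1)^-1 * (Q ^+ m * lam * (1 - irr_defect x i)).
    rewrite -[(Q - 1)^-1]mulr1 -mulr_suml -mulr_sumr one mulVf ?mul1r //.
    by rewrite gt_eqF.
  apply: ler_sum => b b0; rewrite mulrC ler_pdivrMr //.
  have cb : c / b != 0 by rewrite mulf_neq0 ?invr_eq0.
  have im' : (k < m - i < m)%N by move: ki im; clear; lia.
  have /andP[kmi mi] := im'.
  have le1 := IHm _ mi _ kmi cb.
  have le2 := irreducibles_lower_boundr b0 (leq_ltn_trans k0 ki).
  have pos : 0 <= (i * size (irreducibles i b))%:R :> rat by rewrite ler0n.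
  apply: le_trans (_ : (Q - 1) * (i * size (irreducibles i b))%:R * (Q ^+ (m - i) * lam) <= _).
    have -> : Q ^+ m * lam * (1 - irr_defect x i)
        = Q ^+ i * (1 - irr_defect x i) * (Q ^+ (m - i) * lam).
      by rewrite -[in LHS](subnKC (n := m) (m := i)) ?exprD; [ring|move: im; clear; lia].
    by rewrite ler_wpM2r // mulr_ge0 ?exprn_ge0 ?ltW.
  have := ler_wpM2l pos le1; rewrite -/lam !natrM.
  move: (size _)%:R (size _)%:R => N T h.
  have := ler_wpM2l (ltW Q1) h; lra.
have corr := square_defect_corr k0 km2.
have last := irreducibles_lower_boundr c0 (leq_ltn_trans k0 km).
have def := recursion_defect_le x_gt0 x_le k0 km2.
have sumd : \sum_(k.+1 <= i < m - k) (1 - irr_defect x i) >= m%:R - (2 * k%:R + 1 + 5 / 2).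
  rewrite sumrB sumr_const_nat.
  have := sum_irr_defect_le x_gt0 x_le (m - k) (k0 : (1 < k.+1)%N).
  have -> : (m - k - k.+1)%:R = m%:R - (2 * k%:R + 1) :> rat.
    rewrite -subnDA natrB; last by move: km2; clear; lia.
    by rewrite addnS -natr1 natrD; ring.
  lra.
have QL : 0 < Q ^+ m * lam by rewrite mulr_gt0.
have h1 := le_trans (ler_wpM2l (ltW QL) sumd) low.
have h2 := ler_wpM2l (ltW Q1) rec; rewrite !mulrDr in h2.
have h3 := ler_wpM2l (ltW Qm) def; rewrite -/lam mulr1 mulrDr in h3.
rewrite -(ler_pM2r m0) -[leRHS]mulrA -natrM [(_ * m)%N]mulnC -/lam.
exact: recursion_step_arith h1 h2 h3 last corr.
Qed.

Lemma squarefree_avoiding_lower_bound k n c :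
    (0 < k)%N -> (2 * k <= n)%N -> c != 0 ->
  (q ^ n <= 16 * (q.-1 * size (squarefree_avoiding k n c)))%N.
Proof.
move=> k0 kn c0.
have Qn0 := exprn_ge0 n (ltW Q_gt0).
have Q1 : 0 <= Q - 1 by rewrite -natr_pred_card ler0n.
pose lam : rat := (4 * (k%:R + 3))^-1.
have k3 : 0 < k%:R + 3 :> rat by rewrite -natrD ltr0n addn_gt0 k0.
have lam0 : 0 <= lam by rewrite invr_ge0 mulr_ge0 // ltW.
have cnt (j : 'I_k) : Q ^+ (n - j) * lam * (size (squarefree_monics F j))%:R
    <= (Q - 1) * (\sum_(h <- squarefree_monics F j)
         size (rough_squarefree k (n - j) (c / h`_0)%R))%:R.
  rewrite -sum1_size !natr_sum !mulr_sumr big_seq [leRHS]big_seq; apply: ler_sum => h.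
  rewrite mem_filter mulr1 => /andP[/andP[_ h0] _].
  apply: rough_squarefree_lower_bound; rewrite ?mulf_neq0 ?invr_eq0 //.
  by have := ltn_ord j; move: kn; clear; lia.
(* Degree 0 has the full weight 1, as h = 1 is the only choice; the weights then add up to (k + 3) /
   4. *)
have Aj (j : 'I_k) : Q ^+ n * lam * (if j == 0%N :> nat then 1 else 1 / 4)
    <= Q ^+ (n - j) * lam * (size (squarefree_monics F j))%:R.
  case: eqP => [->|_]; first by rewrite subn0 size_squarefree_monics0.
  have -> : Q ^+ n * lam * (1 / 4) = Q ^+ (n - j) * lam * (Q ^+ j / 4).
    rewrite -[in LHS](subnK (_ : j <= n)%N) ?exprD; first by ring.
    by have := ltn_ord j; move: kn; clear; lia.
  apply: ler_wpM2l; first by rewrite mulr_ge0 ?exprn_ge0 // ltW.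
  rewrite ler_pdivrMr // mulrC -natrX -natrM ler_nat.
  exact: size_squarefree_monics.
have tot : Q ^+ n * (1 / 16) <= (Q - 1) * (size (squarefree_avoiding k n c))%:R.
  have le1 : (\sum_(j < k) \sum_(h <- squarefree_monics F j)
      size (rough_squarefree k (n - j) (c / h`_0)%R))%:R
      <= (size (squarefree_avoiding k n c))%:R :> rat.
    by rewrite ler_nat sum_rough_squarefree_leq.
  apply: le_trans (ler_wpM2l Q1 le1); rewrite natr_sum mulr_sumr.
  apply: (@le_trans _ _ (\sum_(j < k) Q ^+ n * lam * (if j == 0%N :> nat then 1 else 1 / 4))).
    rewrite -mulr_sumr -mulrA; apply: (ler_wpM2l Qn0).
    have -> : \sum_(j < k) (if j == 0%N :> nat then 1 else 1 / 4) = (k%:R + 3) / 4 :> rat.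
      rewrite -[in LHS](prednK k0) big_ord_recl /= sumr_const card_ord -mulr_natr.
      by rewrite -[in RHS](prednK k0) -natr1; field.
    by rewrite (_ : lam * _ = 1 / 16) // /lam; field; exact: lt0r_neq0.
  by apply: ler_sum => j _; exact: le_trans (Aj j) (cnt j).
rewrite -(ler_nat rat) natrX !natrM natr_pred_card; move: tot; rewrite -/Q.
move: (size _)%:R => s; lra.
Qed.

End CountLowerBound.

(** * Characteristic polynomials *)

Lemma char_poly_simmx (F : fieldType) (n : nat) (P A B : 'M[F]_n) :
  P \in unitmx -> P *m A = B *m P -> char_poly A = char_poly B.
Proof.
rewrite unitmxE unitfE => uP PA.
have uP' : \det (map_mx polyC P) != 0 by rewrite det_map_mx polyC_eq0.
apply: (mulfI uP'); rewrite [RHS]mulrC -!det_mulmx; congr (\det _).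
by rewrite mulmxBr mulmxBl -!map_mxM PA scalar_mxC.
Qed.

Lemma char_poly_lblock (R : comNzRingType) (n1 n2 : nat)
    (A : 'M[R]_n1) (B : 'M_(n2, n1)) (C : 'M_n2) :
  char_poly (block_mx A 0 B C) = char_poly A * char_poly C.
Proof.
rewrite /char_poly /char_poly_mx map_block_mx map_mx0 scalar_mx_block.
by rewrite opp_block_mx add_block_mx oppr0 addr0 det_lblock.
Qed.

(** In the basis formed by the rows of [V] and [W], [A] is block lower triangular with corner
    [conjmx V A]. *)
Lemma char_poly_conjmx_dvd (F : fieldType) (m n p : nat) (A : 'M[F]_p)
    (V : 'M_(m, p)) (W : 'M_(n, p)) :
    (m + n)%N = p -> row_full (col_mx V W) -> stablemx V A ->
  char_poly (conjmx V A) %| char_poly A.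
Proof.
move=> def_p; case: p / def_p in A V W *; rewrite row_full_unit => uP sV.
set P := col_mx V W in uP *; pose B := P *m A *m invmx P.
have ->: char_poly A = char_poly B by apply: (char_poly_simmx uP); rewrite mulmxKV.
have VP : V *m invmx P = row_mx 1%:M 0.
  have := congr1 usubmx (mulmxV uP).
  by rewrite /P mul_col_mx col_mxKu scalar_mx_block /block_mx col_mxKu.
have uB : usubmx B = row_mx (conjmx V A) 0.
  rewrite /B /P !mul_col_mx col_mxKu -/P.
  have -> : V *m A = conjmx V A *m V by rewrite mulmxKpV.
  by rewrite -mulmxA VP mul_mx_row mulmx1 mulmx0.
rewrite -[B]submxK /ulsubmx /ursubmx uB row_mxKl row_mxKr char_poly_lblock.
exact: dvdp_mulr.
Qed.

Lemma dvdp_char_poly_stable (F : fieldType) (n : nat) (A U : 'M[F]_n) :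
  stablemx U A ->
  exists d : {poly F}, [/\ d \is monic, size d = (\rank U).+1 & d %| char_poly A].
Proof.
move=> sU; exists (char_poly (conjmx (row_base U) A)).
rewrite char_poly_monic size_char_poly; split=> //.
apply: (@char_poly_conjmx_dvd _ _ _ _ _ _ (row_base U^C%MS)).
- by rewrite mxrank_compl subnKC // rank_leq_col.
- rewrite -sub1mx -addsmxE (adds_eqmx (eq_row_base _) (eq_row_base _)).
  by rewrite sub1mx addsmx_compl_full.
- by rewrite stablemx_row_base.
Qed.

Lemma delta_mx_castmx_companion (R : nzRingType) (n : nat) (p : {poly R})
    (e : (size p).-1 = n) (i : 'I_n) (hi : (i.+1 < n)%N) :
  delta_mx 0 i *m castmx (e, e) (companionmx p) = delta_mx 0 (Ordinal hi) :> 'rV_n.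
Proof. by case: _ / e i hi => i hi; rewrite castmx_id (mulmx_delta_companion hi). Qed.

(** The first basis vector is cyclic: [A] moves each basis vector to the next, so row i + 1 of a
    commuting matrix is row i times [A]. *)
Lemma companion_cyclic (R : nzRingType) (n : nat) (p : {poly R})
    (e : (size p).-1 = n.+1) (A := castmx (e, e) (companionmx p)) (X Y : 'M_n.+1) :
    A *m X = X *m A -> A *m Y = Y *m A -> row 0 X = row 0 Y -> X = Y.
Proof.
move=> cX cY XY0; apply/row_matrixP=> -[i hi].
elim: i hi => [|i IHi] hi.
  by have -> : Ordinal hi = 0 by apply: val_inj.
have hi' : (i < n.+1)%N := ltnW hi.
have rE Z : A *m Z = Z *m A -> row (Ordinal hi) Z = row (Ordinal hi') Z *m A.
  move=> cZ; rewrite !rowE -(delta_mx_castmx_companion e (i := Ordinal hi') hi) -!mulmxA.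
  by rewrite cZ.
by rewrite (rE _ cX) (rE _ cY) IHi.
Qed.

Lemma det_GLval_neq0 (n : nat) (F : finFieldType) (x : {'GL_n[F]}) :
  \det (GLval x) != 0.
Proof. by rewrite -unitfE -unitmxE; exact: (GL_unitmx x). Qed.

(** * Class sizes and orders in the general linear group *)

Section GeneralLinear.

Variables (n : nat) (F : finFieldType).
Local Notation G := [set: {'GL_n.+1[F]}].

(** Orbit-stabilizer for the companion matrix of [f], invertible as f(0) is nonzero; its centralizer
    embeds into row vectors. *)
Lemma card_char_poly_class (f : {poly F}) :
    f \is monic -> size f = n.+2 -> f`_0 != 0 ->
  (#|G| <= #|[set x : {'GL_n.+1[F]} | char_poly (GLval x) == f]| * #|F| ^ n.+1)%N.
Proof.
move=> fm sf f0.
have e : (size f).-1 = n.+1 by rewrite sf.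
pose A := castmx (e, e) (companionmx f).
have pA : char_poly A = f.
  rewrite -[RHS]companionmxK // /A; move: e {A}; case: _ /.
  by rewrite castmx_id.
have uA : A \is a GRing.unit.
  rewrite -[_ \is a _]/(A \in unitmx) unitmxE unitfE.
  apply: contra_neq f0 => dA; rewrite -pA char_poly_det.
  by rewrite dA mulr0.
pose a : {'GL_n.+1[F]} := Sub A uA.
have cl : (a ^: G)%g \subset [set x : {'GL_n.+1[F]} | char_poly (GLval x) == f].
  apply/subsetP => _ /imsetP[x _ ->]; rewrite inE -pA.
  have ax := GL_ME x (a ^ x)%g; rewrite -conjgC in ax.
  apply/eqP; apply: (@char_poly_simmx _ _ (GLval x)); first exact: GL_unitmx.
  by rewrite -[LHS]/(GLval x * GLval (a ^ x)%g) -ax GL_ME.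
have cC : (#|'C[a]%g| <= #|F| ^ n.+1)%N.
  have -> : (#|F| ^ n.+1 = #|{: 'rV[F]_n.+1}|)%N by rewrite card_mx mul1n.
  rewrite -(card_in_imset (f := fun x => row 0 (GLval x))); first exact: max_card.
  move=> x y /cent1P cx /cent1P cy xy; apply: val_inj.
  have cE z : commute a z -> A *m GLval z = GLval z *m A.
    by move=> /(congr1 GLval); rewrite !GL_MxE.
  by apply: (companion_cyclic (cE _ _) (cE _ _) xy); apply/commute_sym.
rewrite -(Lagrange (subsetT 'C[a]%g)) mulnC.
have <- : #|(a ^: G)%g| = #|G : 'C[a]%g|%g by rewrite -index_cent1 setTI.
exact: leq_mul (subset_leq_card cl) cC.
Qed.

(** The fibres of the determinant are the cosets of [SL] by the matrices diag(a, 1, ..., 1). *)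
Lemma card_GL_SL : (#|G| = #|SL n.+1 F| * #|F|.-1)%N.
Proof.
pose D (a : F) : 'M[F]_n.+1 := diag_mx (\row_j (if j == 0 then a else 1)).
have detD a : \det (D a) = a.
  rewrite det_diag (bigD1 0) //= mxE eqxx big1 ?mulr1 // => i /negPf i0.
  by rewrite mxE i0.
have uD a : a != 0 -> D a \is a GRing.unit.
  by move=> a0; rewrite -[_ \is a _]/(D a \in unitmx) unitmxE detD unitfE.
have fib a : a != 0 -> #|[set x : {'GL_n.+1[F]} | \det (GLval x) == a]| = #|SL n.+1 F|.
  move=> a0; pose g : {'GL_n.+1[F]} := Sub (D a) (uD a a0).
  rewrite -(card_lcoset (SL n.+1 F) g); apply: eq_card => x.
  rewrite mem_lcoset !inE GL_ME GL_VE.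
  rewrite det_mulmx -[(GLval g)^-1]/(invmx (D a)) det_inv detD.
  by apply/eqP/eqP=> [->|h]; [rewrite mulVf | rewrite -[LHS](mulVKf a0) h mulr1].
have cF : #|[pred a : F | a != 0]| = #|F|.-1 by rewrite (cardC1 0).
rewrite -sum1_card (partition_big (fun x => \det (GLval x)) (fun a => a != 0)) /=; last first.
  by move=> x _; exact: (det_GLval_neq0 x).
rewrite (eq_bigr (fun=> #|SL n.+1 F|)); first by rewrite sum_nat_const cF mulnC.
by move=> a a0; rewrite -(fib a a0) -sum1_card; apply: eq_bigl => x; rewrite !inE.
Qed.

End GeneralLinear.

(** * From polynomials to elements of a coset *)

(** The constant term [c] fixes the determinant, so elements whose characteristic polynomial is on
    the list lie in the coset of [g]. *)
Lemma card_char_poly_squarefree_avoiding (n k : nat) (F : finFieldType)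
    (g : {'GL_n.+1[F]}) (c := (-1) ^+ n.+1 * \det (GLval g)) :
  (size (squarefree_avoiding k n.+1 c) * #|[set: {'GL_n.+1[F]}]|
    <= #|[set x in (g *: SL n.+1 F)%g |
          `[< regular_semisimple x /\ derangement_on_spaces k x >]]| * #|F| ^ n.+1)%N.
Proof.
set A := [set x in _ | _]; set s := squarefree_avoiding k n.+1 c.
pose cl f := [set x : {'GL_n.+1[F]} | char_poly (GLval x) == f].
have c0 : c != 0.
  by rewrite mulf_neq0 ?signr_eq0 ?(det_GLval_neq0 g).
have le_cl : (size s * #|[set: {'GL_n.+1[F]}]| <= (\sum_(f <- s) #|cl f|) * #|F| ^ n.+1)%N.
  rewrite -sum1_size !big_distrl /= big_seq [leqRHS]big_seq; apply: leq_sum => f.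
  rewrite mem_filter mem_monics mul1n => /andP[/and3P[_ _ /eqP f0] /andP[fm /eqP sf]].
  by apply: card_char_poly_class; rewrite ?f0.
apply: leq_trans le_cl _; rewrite leq_mul2r; apply/orP; right.
have -> : (\sum_(f <- s) #|cl f| =
    \sum_(x : {'GL_n.+1[F]}) count_mem (char_poly (GLval x)) s)%N.
  under eq_bigr => f _ do rewrite -sum1_card.
  rewrite (exchange_big_dep predT) //=; apply: eq_bigr => x _.
  by rewrite -sum1_count; apply: eq_bigl => f; rewrite inE eq_sym.
rewrite -sum1_card big_mkcond /= [leqRHS]big_mkcond; apply: leq_sum => x _.
rewrite count_uniq_mem ?filter_uniq ?monics_uniq //.
case: (boolP (_ \in s)) => // xs; suff -> : x \in A by [].
move: xs; rewrite mem_filter mem_monics => /andP[/and3P[/asboolP sqf /asboolP nodvd /eqP f0] _].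
rewrite inE; apply/andP; split.
  rewrite mem_lcoset inE GL_ME GL_VE det_mulmx.
  move: f0; rewrite char_poly_det /c => /(mulfI _) -> //; last by rewrite signr_eq0.
  rewrite -[(GLval g)^-1]/(invmx (GLval g)) det_inv.
  by rewrite mulVf ?(det_GLval_neq0 g).
apply/asboolP; split=> // -[U [rU sU]].
have [d [_ sd dvd_d]] := dvdp_char_poly_stable sU.
by apply: nodvd dvd_d _; rewrite sd rU.
Qed.

Theorem theorem9p3 (k : nat) (hk : (1 <= k)%N) :
  exists N : nat, forall (n : nat) (F : finFieldType),
    (2 * k <= n)%N -> (N <= #|SL n F|)%N ->
    forall g : {'GL_n[F]},
      (1 / 16%:R <=
         proportion (g *: SL n F)%g
           (fun x => regular_semisimple x /\ derangement_on_spaces k x))%R.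
Proof.
exists 0%N => -[|n] F kn _ g.
  by exfalso; move: hk kn; clear; case: k.
have c0 : (-1) ^+ n.+1 * \det (GLval g) != 0.
  by rewrite mulf_neq0 ?signr_eq0 ?(det_GLval_neq0 g).
have := card_char_poly_squarefree_avoiding k g.
have := squarefree_avoiding_lower_bound hk kn c0.
rewrite /proportion card_lcoset card_GL_SL; set A := #|[set _ in _ | _]|; set s := size _.
have SL0 : (0 < #|SL n.+1 F|)%N := cardG_gt0 _.
have q1 : (0 < #|F|.-1)%N by rewrite -ltnS prednK ?finNzRing_gt1 // ltnW ?finNzRing_gt1.
have qn : (0 < #|F| ^ n.+1)%N by rewrite expn_gt0 ltnW ?finNzRing_gt1.
move=> le_s le_A.
(* |SL| (q - 1) s = |GL| s <= A q^(n+1) <= 16 A (q - 1) s, and the positive factor (q - 1) s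
   cancels. *)
suff le16 : (#|SL n.+1 F| <= 16 * A)%N.
  rewrite ler_pdivrMr; last by rewrite ltr0n.
  rewrite mulrAC ler_pdivlMr; last by rewrite ltr0n.
  by rewrite mul1r mulrC -natrM ler_nat.
have sq0 : (0 < #|F|.-1 * s)%N by move: (leq_trans qn le_s); rewrite muln_gt0 => /andP[].
rewrite -(leq_pmul2r sq0) -mulnA [leqRHS]mulnCA.
apply: leq_trans (leq_mul (leqnn A) le_s); apply: leq_trans le_A.
by rewrite [leqRHS]mulnC mulnA.
Qed.
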